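(* For any $\delta \in (0,1)$ and any $C > 0$ there is a function $F:\mathbb{R}\to\mathbb{R}$ which is $C^\infty$, real, even, nonnegative, supported in $[-1,1]$, and whose Fourier transform $\widehat{F}(k)$ is monotone decreasing for $k \geq 0$ and satisfies, for $k \ge 0$, the double inequality $$e^{-(1+\epsilon) C k^\delta} \lesssim \widehat{F}(k) \lesssim e^{-(1-\epsilon) C k^\delta}$$ for any $\epsilon > 0$. (The function $F$ depends only on $\delta$ and $C$, not on $\epsilon$; the implied constants may depend on $\epsilon$.)
   Context: The Fourier transform is $\widehat{f}(k) = \int_{\mathbb{R}} e^{-2\pi i k x} f(x)\,dx$. The notation $f_1(k) \lesssim f_2(k)$ means that there is a constant $c>0$, independent of $k$, such that $f_1(k) \leq c\, f_2(k)$ for all $k$ in the range considered. Since $F$ is real and even, $\widehat{F}$ is real-valued and even. *)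

(* Defs.v *)
From HB Require Import structures.
From mathcomp Require Import all_boot all_order all_algebra.
From mathcomp Require Import all_classical all_reals all_analysis.
From mathcomp Require Import complex.

Set Implicit Arguments.
Unset Strict Implicit.
Unset Printing Implicit Defensive.

Import Order.TTheory GRing.Theory Num.Theory.
Import numFieldNormedType.Exports.

Local Open Scope classical_set_scope.
Local Open Scope ring_scope.
Local Open Scope complex_scope.

Definition smooth (R : realType) (f : R -> R) : Prop :=
  forall (n : nat) (x : R), derivable (f^`(n))%classic x 1.

(* The topological support. *)
Definition supp (R : realType) (f : R -> R) : set R :=
  closure [set x | f x != 0].

(* [expi t] is e^{it}. *)
Definition expi (R : realType) (t : R) : R[i] := cos t +i* sin t.

(* Lebesgue integral over the line of a complex-valued function, taken
   componentwise. It is total: it is only meaningful when both components are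
   integrable, which is automatic for continuous compactly supported [g]. *)
Definition cintegral (R : realType) (g : R -> R[i]) : R[i] :=
  (\int[@lebesgue_measure R]_x complex.Re (g x))
  +i* (\int[@lebesgue_measure R]_x complex.Im (g x)).

Definition fourier (R : realType) (f : R -> R) (k : R) : R[i] :=
  cintegral (fun x => expi (- (2 * pi * k * x)) * (f x)%:C).

(* [f] is bounded on [D] by a constant multiple of [g]. *)
Definition lesssim (R : realType) (D : set R) (f g : R -> R) : Prop :=
  exists2 c : R, 0 < c & forall k, D k -> f k <= c * g k.

(* Main.v *)
Require Import Defs.
From HB Require Import structures.
From mathcomp Require Import all_boot all_order all_algebra.
From mathcomp Require Import all_classical all_reals all_analysis.
From mathcomp Require Import complex.
From mathcomp Require Import ring lra.

Import Order.TTheory GRing.Theory Num.Theory.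
Import numFieldNormedType.Exports.

Local Open Scope classical_set_scope.
Local Open Scope ring_scope.

(** Let rho(w) = 6 (w - sin w) / w^3, the Fourier transform (in angular frequency)
    of the kernel (3/2) (1 - |x|)_+^2. It is positive and, by the Cusa-Huygens
    inequality 3 sin w <= w (2 + cos w), decreasing on w > 0. Hence an infinite
    convolution F of rescaled copies of this kernel, with widths a_j = c j^(-1/delta)
    for j > N, is a smooth even bump function whose transform prod_j rho(a_j w) is
    automatically positive and decreasing. With x = (c w)^delta the exponent
    - sum_j ln rho(a_j w) is sum_j theta(x / j) with theta nondecreasing. The full
    sums S(x) = sum_(j >= 1) theta(x / j) satisfy S(m x) >= m S(x), so S(x) <= I x and
    S(x) >= (I - e) x - O(1) for I = sup S(x) / x. The constant c is chosen so that
    I x = C k^delta, and dropping the first N factors, which makes the support fit in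
    [-1, 1], only costs sum_(j <= N) theta(x / j) = o(x). *)

(** * Derivatives, integrals and antiderivatives of continuous functions on the line *)

Section Calculus.
Set Implicit Arguments.
Unset Strict Implicit.
Unset Printing Implicit Defensive.
Context {R : realType}.
Implicit Types (f g P Q : R -> R) (a b t x : R).
Local Notation mu := (@lebesgue_measure R).

(* [is_derive] is a class, so premises of that type are discharged by instance
   search, which interferes with syntax-directed differentiation. *)
Definition has_deriv x f a := is_derive x (1 : R) f a.

Lemma has_deriv_eq f a b x : has_deriv x f a -> a = b -> has_deriv x f b.
Proof. by move=> fa <-. Qed.

Lemma has_deriv_id x : has_deriv x (fun y : R => y) 1.
Proof. exact: is_derive_id. Qed.

Lemma has_deriv_cst a x : has_deriv x (fun _ : R => a) 0.
Proof. exact: is_derive_cst. Qed.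

Lemma has_derivD f g a b x : has_deriv x f a -> has_deriv x g b ->
  has_deriv x (fun y => f y + g y) (a + b).
Proof. exact: is_deriveD. Qed.

Lemma has_derivN f a x : has_deriv x f a -> has_deriv x (fun y => - f y) (- a).
Proof. exact: is_deriveN. Qed.

Lemma has_derivM f g a b x : has_deriv x f a -> has_deriv x g b ->
  has_deriv x (fun y => f y * g y) (a * g x + f x * b).
Proof.
rewrite /has_deriv => fa gb; apply: is_derive_eq (is_deriveM _ _) _.
by rewrite /GRing.scale /= addrC mulrC [f x * _]mulrC mulrC [b * _]mulrC.
Qed.

Lemma has_deriv_comp f g a b x : has_deriv x g b -> has_deriv (g x) f a ->
  has_deriv x (fun y => f (g y)) (a * b).
Proof. by rewrite /has_deriv => gb fa; exact: is_derive1_comp. Qed.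

Lemma has_derivX f a n x : has_deriv x f a ->
  has_deriv x (fun y => f y ^+ n.+1) (n.+1%:R * f x ^+ n * a).
Proof.
move=> fa; elim: n => [|n IHn]; first by rewrite expr0 !mul1r.
apply: has_deriv_eq (has_derivM fa IHn) _.
by rewrite [in RHS]mulrSr !exprS; ring.
Qed.

Lemma has_deriv_sin x : has_deriv x (fun y : R => sin y) (cos x).
Proof. exact: is_derive_sin. Qed.

Lemma has_deriv_cos x : has_deriv x (fun y : R => cos y) (- sin x).
Proof. exact: is_derive_cos. Qed.

Lemma has_deriv_continuous f g : (forall x, has_deriv x f (g x)) -> continuous f.
Proof.
move=> fg x; apply: differentiable_continuous; apply/derivable1_diffP.
by have [] := fg x.
Qed.

Lemma cont_id : continuous (fun x : R => x).
Proof. by move=> x; exact: cvg_id. Qed.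

Lemma cont_cst a : continuous (fun _ : R => a).
Proof. by move=> x; exact: cvg_cst. Qed.

Lemma contD f g : continuous f -> continuous g -> continuous (fun x => f x + g x).
Proof. by move=> fc gc x; apply: cvgD; [exact: fc|exact: gc]. Qed.

Lemma contN f : continuous f -> continuous (fun x => - f x).
Proof. by move=> fc x; apply: cvgN; exact: fc. Qed.

Lemma contM f g : continuous f -> continuous g -> continuous (fun x => f x * g x).
Proof. by move=> fc gc x; apply: cvgM; [exact: fc|exact: gc]. Qed.

Lemma contX f n : continuous f -> continuous (fun x => f x ^+ n).
Proof.
move=> fc; elim: n => [|n IHn]; first exact: cont_cst.
rewrite (_ : (fun x => _) = (fun x => f x * f x ^+ n)); first exact: contM.
by apply/funext => x; rewrite exprS.
Qed.

Lemma cont_comp f g : continuous g -> continuous f -> continuous (fun x => f (g x)).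
Proof. by move=> gc fc x; apply: continuous_comp; [exact: gc|exact: fc]. Qed.

Lemma continuous_integrable f a b : continuous f -> mu.-integrable `[a, b] (EFin \o f).
Proof.
move=> fc; apply: continuous_compact_integrable; first exact: segment_compact.
exact: continuous_subspaceT.
Qed.

Lemma Rintegral_FTC f P a b : a <= b -> continuous f ->
  (forall x, has_deriv x P (f x)) ->
  \int[mu]_(x in `[a, b]) f x = P b - P a.
Proof.
rewrite le_eqVlt => /predU1P[<-|ab] fc Pf.
  by rewrite set_itv1 Rintegral_set1 subrr.
have Pc := has_deriv_continuous Pf.
rewrite /Rintegral (continuous_FTC2 (F := P) ab) //.
- exact: continuous_subspaceT.
- split.
  + by move=> x _; have [] := Pf x.
  + by apply: cvg_at_right_filter; exact: Pc.
  + by apply: cvg_at_left_filter; exact: Pc.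
- by move=> x _; rewrite derive1E (@derive_val _ _ _ _ _ _ _ (Pf x)).
Qed.

Lemma has_deriv_eq0_cst f : (forall x, has_deriv x f 0) -> forall x y, f x = f y.
Proof. by move=> f0 x y; apply: is_derive_0_is_cst. Qed.

Lemma has_deriv_le f g (a b : R) : a <= b ->
  (forall x, has_deriv x f (g x)) -> (forall x, a <= x <= b -> 0 <= g x) -> f a <= f b.
Proof.
move=> ab fg g0; have fc := has_deriv_continuous fg.
have : - f b <= - f a; last by rewrite lerN2.
apply: (@ler0_derive1_le_cc _ (fun x => - f x) a b) => //.
- by move=> x _; have [] := has_derivN (fg x).
- move=> x /[!in_itv] /= /andP[/ltW ax /ltW xb].
  by rewrite derive1E (@derive_val _ _ _ _ _ _ _ (has_derivN (fg x))) oppr_le0 g0 // ax.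
- by apply: continuous_subspaceT => x; apply: continuousN; exact: fc.
- by rewrite in_itv /= ab lexx.
- by rewrite in_itv /= ab lexx.
Qed.

(** The integral [J b] is differentiated only to the right of its base point [b]. Since an interval
    with reversed ends is empty, [J 0 x - J x 0] is the signed integral from 0 to [x]; near each
    point it agrees, up to a constant, with [J b] for a [b] far enough to the left. *)
Lemma antiderivative f : continuous f ->
  exists P, forall x, has_deriv x P (f x).
Proof.
move=> fc.
pose J b x := \int[mu]_(t in `[b, x]) f t.
have Jd b x : b < x -> has_deriv x (J b) (f x).
  move=> bx; have [] := @continuous_FTC1_closed _ f b x (x + 1).
  - by rewrite ltrDl.
  - exact: continuous_integrable.
  - exact: bx.
  - exact: fc.
  move=> dJ; rewrite derive1E => <-; exact: derivableP.
have JB b b' x : b <= b' -> b' <= x -> J b x - J b' x = J b b'.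
  move=> bb' b'x.
  have := @Rintegral_itvB _ f (BLeft b) (BRight x) b' (@continuous_integrable _ b x fc).
  rewrite !bnd_simp => /(_ bb' b'x).
  rewrite Rintegral_itv_obnd_cbnd; last first.
    by apply: integrableS (@continuous_integrable _ b' x fc) => //; apply: subset_itvr; rewrite bnd_simp.
  by rewrite /J => <-; rewrite subKr.
pose P x := J 0 x - J x 0.
exists P => x.
pose b := - `|x| - 1.
have bx : b < x by rewrite /b; have := ler_norm (- x); rewrite normrN; lra.
have b0 : b < 0 by rewrite /b; have := normr_ge0 x; lra.
have PJ y : b <= y -> P y = J b y - J b 0.
  move=> by_; rewrite /P; have [y0|y0] := leP 0 y.
    suff -> : J y 0 = 0 by have := @JB b 0 y (ltW b0) y0; lra.
    move: y0; rewrite /J le_eqVlt => /predU1P[<-|y0].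
      by rewrite set_itv1 Rintegral_set1.
    by rewrite set_itv_ge ?Rintegral_set0 // bnd_simp -ltNge.
  suff -> : J 0 y = 0 by have := @JB b y 0 by_ (ltW y0); lra.
  by rewrite /J set_itv_ge ?Rintegral_set0 // bnd_simp -ltNge.
have : has_deriv x (fun y => J b y - J b 0) (f x).
  apply: has_deriv_eq (has_derivD (Jd _ _ bx) (has_derivN (has_deriv_cst _ _))) _.
  by rewrite oppr0 addr0.
apply: near_eq_is_derive; near=> y; rewrite PJ //.
by apply/ltW; near: y; exact: lt_nbhsr.
Unshelve. all: by end_near. Qed.

End Calculus.

(** * Syntax-directed differentiation and continuity *)

Ltac der := repeat
  match goal with
    | |- has_deriv _ (fun _ => ?c) _ => apply: has_deriv_cst
    | |- has_deriv _ (fun y => y) _ => apply: has_deriv_id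
    | |- has_deriv _ (fun y => @?f y + @?g y) _ => apply: has_derivD
    | |- has_deriv _ (fun y => - (@?f y)) _ => apply: has_derivN
    | |- has_deriv _ (fun y => @?f y * @?g y) _ => apply: has_derivM
    | |- has_deriv _ (fun y => @?f y ^+ _.+1) _ => apply: has_derivX
    | |- has_deriv _ (fun y => sin (@?f y)) _ =>
        apply: (has_deriv_comp _ (has_deriv_sin _))
    | |- has_deriv _ (fun y => cos (@?f y)) _ =>
        apply: (has_deriv_comp _ (has_deriv_cos _))
    | H : forall y, has_deriv y ?P _ |- has_deriv _ (fun y => ?P (@?g y)) _ =>
        apply: (has_deriv_comp _ (H _))
    | H : forall y, has_deriv y ?P _ |- has_deriv _ ?P _ => apply: H
    | |- has_deriv _ sin _ => apply: has_deriv_sin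
    | |- has_deriv _ ( *%R ?a) _ =>
        apply: (has_derivM (@has_deriv_cst _ a _) (@has_deriv_id _ _))
    | |- has_deriv _ (+%R ?a) _ =>
        apply: (has_derivD (@has_deriv_cst _ a _) (@has_deriv_id _ _))
    | |- has_deriv _ -%R _ => apply: (has_derivN (@has_deriv_id _ _))
    | |- has_deriv _ cos _ => apply: has_deriv_cos
    end.

Ltac cont := repeat
  match goal with
    | H : continuous ?f |- continuous ?f => exact: H
    | |- continuous (fun _ => ?c) => exact: cont_cst
    | |- continuous (fun y => y) => apply: cont_id
    | |- continuous (fun y => @?f y + @?g y) => apply: contD
    | |- continuous (fun y => - (@?f y)) => apply: contN
    | |- continuous (fun y => @?f y * @?g y) => apply: contM
    | |- continuous (fun y => @?f y ^+ _) => apply: contX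
    | |- continuous (fun y => sin (@?f y)) => apply: (cont_comp _ (@continuous_sin _))
    | |- continuous (fun y => cos (@?f y)) => apply: (cont_comp _ (@continuous_cos _))
    | H : continuous ?f |- continuous (fun y => ?f (@?g y)) => apply: (cont_comp _ H)
    | |- continuous sin => apply: continuous_sin
    | |- continuous ( *%R ?a) => exact: (contM (@cont_cst _ a) (@cont_id _))
    | |- continuous (+%R ?a) => exact: (contD (@cont_cst _ a) (@cont_id _))
    | |- continuous -%R => exact: (contN (@cont_id _))
    | |- continuous cos => apply: continuous_cos
    end.

(** * Trigonometric inequalities and the factor [rho] *)

Section Profile.
Set Implicit Arguments.
Unset Strict Implicit.
Unset Printing Implicit Defensive.
Context {R : realType}.
Implicit Types (u x : R).

Lemma ge0_deriv (f g : R -> R) (b : R) : 0 <= b -> f 0 = 0 ->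
  (forall x, has_deriv x f (g x)) -> (forall x, 0 <= x <= b -> 0 <= g x) ->
  0 <= f b.
Proof. by move=> b0 f0 fg g0; rewrite -f0; exact: has_deriv_le fg g0. Qed.

(** Start of a chain of Taylor bounds: each follows by integrating the previous one from 0, this one
    from [cos y <= 1]. *)
Lemma sin_le_id x : 0 <= x -> sin x <= x.
Proof.
move=> x0; rewrite -subr_ge0.
apply: (@ge0_deriv (fun y => y - sin y) (fun y => 1 - cos y)).
- by [].
- by rewrite sin0 subr0.
- by move=> y; der.
- by move=> y _; rewrite subr_ge0 cos_le1.
Qed.

Lemma cos_ge_taylor2 x : 0 <= x -> 1 - x ^+ 2 / 2 <= cos x.
Proof.
move=> x0; rewrite -subr_ge0.
apply: (@ge0_deriv (fun y => cos y - (1 - y ^+ 2 / 2)) (fun y => y - sin y)).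
- by [].
- by rewrite cos0; lra.
- by move=> y; apply: has_deriv_eq; [der|rewrite /=; field].
- by move=> y /andP[y0 _]; rewrite subr_ge0 sin_le_id.
Qed.

Lemma sin_ge_taylor3 x : 0 <= x -> x - x ^+ 3 / 6 <= sin x.
Proof.
move=> x0; rewrite -subr_ge0.
apply: (@ge0_deriv (fun y => sin y - (y - y ^+ 3 / 6))
  (fun y => cos y - (1 - y ^+ 2 / 2))).
- by [].
- by rewrite sin0; lra.
- by move=> y; apply: has_deriv_eq; [der|rewrite /=; field].
- by move=> y /andP[y0 _]; rewrite subr_ge0 cos_ge_taylor2.
Qed.

Lemma cos_le_taylor4 x : 0 <= x -> cos x <= 1 - x ^+ 2 / 2 + x ^+ 4 / 24.
Proof.
move=> x0; rewrite -subr_ge0.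
apply: (@ge0_deriv (fun y => 1 - y ^+ 2 / 2 + y ^+ 4 / 24 - cos y)
  (fun y => sin y - (y - y ^+ 3 / 6))).
- by [].
- by rewrite cos0; lra.
- by move=> y; apply: has_deriv_eq; [der|rewrite /=; field].
- by move=> y /andP[y0 _]; rewrite subr_ge0 sin_ge_taylor3.
Qed.

Lemma sin_le_taylor5 x : 0 <= x -> sin x <= x - x ^+ 3 / 6 + x ^+ 5 / 120.
Proof.
move=> x0; rewrite -subr_ge0.
apply: (@ge0_deriv (fun y => y - y ^+ 3 / 6 + y ^+ 5 / 120 - sin y)
  (fun y => 1 - y ^+ 2 / 2 + y ^+ 4 / 24 - cos y)).
- by [].
- by rewrite sin0; lra.
- by move=> y; apply: has_deriv_eq; [der|rewrite /=; field].
- by move=> y /andP[y0 _]; rewrite subr_ge0 cos_le_taylor4.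
Qed.

(** Up to [pi], three differentiations lead to [0 <= y * sin y]. Beyond [pi] the right-hand side is
    at least [u], while the left-hand side is nonpositive up to [2 * pi] and at most 3
    afterwards. *)
Lemma three_sin_le u : 0 <= u -> 3 * sin u <= u * (2 + cos u).
Proof.
move=> u0; have pi2 : 2 <= pi :> R by exact: pi_ge2.
have [upi|piu] := leP u pi; last first.
  have [u2pi|u2pi] := leP u (2 * pi).
    have : 0 <= sin (u - pi) by apply: sin_ge0_pi; apply/andP; split; lra.
    have := sinDpi (u - pi); rewrite subrK => -> su.
    have := cos_geN1 u; nra.
  have := cos_geN1 u; have := sin_le1 u; nra.
have sin_ge0 y : 0 <= y <= u -> 0 <= sin y.
  by move=> /andP[y0 yu]; apply: sin_ge0_pi; rewrite y0 (le_trans yu).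
rewrite -subr_ge0.
apply: (@ge0_deriv (fun y => y * (2 + cos y) - 3 * sin y)
  (fun y => 2 - 2 * cos y - y * sin y)).
- by [].
- by rewrite sin0; lra.
- by move=> y; apply: has_deriv_eq; [der|rewrite /=; ring].
move=> y /andP[y0 yu].
apply: (@ge0_deriv (fun y => 2 - 2 * cos y - y * sin y)
  (fun y => sin y - y * cos y)).
- by [].
- by rewrite sin0 cos0; lra.
- by move=> z; apply: has_deriv_eq; [der|rewrite /=; ring].
move=> z /andP[z0 zy].
apply: (@ge0_deriv (fun y => sin y - y * cos y) (fun y => y * sin y)).
- by [].
- by rewrite sin0; lra.
- by move=> v; apply: has_deriv_eq; [der|rewrite /=; ring].
move=> v /andP[v0 vz]; rewrite mulr_ge0 // sin_ge0 // v0.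
by rewrite (le_trans vz) // (le_trans zy).
Qed.

Lemma has_deriv_expR x : has_deriv x (fun y : R => expR y) (expR x).
Proof. exact: is_derive_expR. Qed.

(* At u = 0 division by zero gives rho 0 = 0 instead of the limit 1. *)
Definition rho u : R := 6 * (u - sin u) / u ^+ 3.

Lemma rho_le1 u : 0 < u -> rho u <= 1.
Proof.
move=> u0; rewrite /rho ler_pdivrMr ?exprn_gt0 // mul1r.
have := sin_ge_taylor3 (ltW u0); lra.
Qed.

(** For [u <= 4] the fifth-order bound on [sin] reduces the claim to [u ^+ 2 <= 19]; for larger [u]
    the bound [sin u <= 1] is enough. It follows that - ln (rho u) is at most ln (1 + u^2), which is
    quadratically small at 0 and only logarithmic at infinity. *)
Lemma rho_lower u : 0 < u -> (1 + u ^+ 2)^-1 <= rho u.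
Proof.
move=> u0; have u20 : 0 < u ^+ 2 by rewrite exprn_gt0.
have u30 : 0 < u ^+ 3 by rewrite exprn_gt0.
rewrite /rho ler_pdivlMr // mulrC ler_pdivrMr ?addr_gt0 //.
have [u1|u1] := ltP 4 u.
  have := sin_le1 u; have -> : u ^+ 3 = u * u ^+ 2 by rewrite -exprS.
  nra.
have := sin_le_taylor5 (ltW u0).
have -> : u ^+ 5 = u ^+ 3 * u ^+ 2 by rewrite -exprD.
move: u20 u30 u1; have -> : u ^+ 3 = u * u ^+ 2 by rewrite -exprS.
set v := u ^+ 2 => v0 uv0 u1 H.
have v16 : v <= 16 by rewrite /v; nra.
apply: (@le_trans _ _ (6 * (u * v / 6 - u * v * v / 120) * (1 + v))).
  have : 0 <= u * v * (v * (19 - v)) by rewrite !mulr_ge0 ?(ltW uv0) ?(ltW v0) //; lra.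
  by lra.
rewrite ler_wpM2r ?addr_ge0 ?(ltW v0) // ler_wpM2l //; lra.
Qed.

Lemma rho_gt0 u : 0 < u -> 0 < rho u.
Proof.
move=> u0; apply: lt_le_trans (rho_lower u0).
by rewrite invr_gt0 ltr_wpDr ?sqr_ge0.
Qed.

Lemma rho_nonincreasing u v : 0 < u -> u <= v -> rho v <= rho u.
Proof.
move=> u0 uv; have v0 : 0 < v by apply: lt_le_trans uv.
(* The substitution u = e^y makes the quotient differentiable on the whole line. *)
pose f (y : R) := (expR y - sin (expR y)) * expR (- (3 * y)).
have rhoE (y : R) : 0 < y -> rho y = 6 * f (ln y).
  move=> y0; rewrite /f expRN expRM_natl lnK ?posrE // /rho mulrA.
  by [].
rewrite !rhoE // ler_wpM2l // -lerN2.
apply: (@has_deriv_le _ (fun y => - f y) (fun y => expR (- (3 * y)) *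
  (expR y * (2 + cos (expR y)) - 3 * sin (expR y)))).
- by rewrite ler_ln.
- move=> y; apply: has_deriv_eq.
    apply: has_derivN; apply: has_derivM.
      apply: has_derivD; first exact: has_deriv_expR.
      apply: has_derivN; apply: (has_deriv_comp (f := sin)); first exact: has_deriv_expR.
      exact: has_deriv_sin.
    apply: (has_deriv_comp (f := expR)); first by der.
    exact: has_deriv_expR.
  by rewrite /=; ring.
- move=> y _; rewrite mulr_ge0 ?expR_ge0 // subr_ge0 three_sin_le //.
Qed.

End Profile.

(** * Convolution with the quadratic kernel and its effect on cosine integrals *)

Section Averaging.
Set Implicit Arguments.
Unset Strict Implicit.
Unset Printing Implicit Defensive.
Context {R : realType}.
Implicit Types (f h P Q : R -> R) (a e w x y : R).
Local Notation mu := (@lebesgue_measure R).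

(* Convolution with the probability density (3 / (2 a)) (1 - |x| / a)_+^2. *)
Definition avg a f x : R :=
  \int[mu]_(s in `[0, 1]) (3 / 2 * (1 - s) ^+ 2 * (f (x + a * s) + f (x - a * s))).

(** Integration by parts until the quadratic weight is exhausted. The average becomes a combination
    of iterated antiderivatives of [f], from which its regularity and its transform can be read
    off. *)
Lemma avgE a f P Q T x : 0 < a -> continuous f ->
  (forall y, has_deriv y P (f y)) -> (forall y, has_deriv y Q (P y)) ->
  (forall y, has_deriv y T (Q y)) ->
  avg a f x = 3 / a ^+ 3 * (T (x + a) - T (x - a)) - 6 / a ^+ 2 * Q x.
Proof.
move=> a0 fc Pd Qd Td; have aN0 : a != 0 by rewrite gt_eqF.
rewrite /avg (@Rintegral_FTC _ _ (fun s => 3 / 2 *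
  ((1 - s) ^+ 2 * (a^-1 * (P (x + a * s) - P (x - a * s))) +
   (2 * (1 - s)) * (a^-1 ^+ 2 * (Q (x + a * s) + Q (x - a * s))) +
   2 * (a^-1 ^+ 3 * (T (x + a * s) - T (x - a * s)))))).
- by rewrite !mulr1 !mulr0 !addr0 !subr0; field.
- exact: ler01.
- by cont.
- by move=> s; apply: has_deriv_eq; [der|rewrite /=; field].
Qed.

Lemma le_avg a e f h x y : continuous f -> continuous h ->
  (forall s, 0 <= s <= 1 ->
     f (x + a * s) + f (x - a * s) <= h (y + a * s) + h (y - a * s) + 2 * e) ->
  avg a f x <= avg a h y + e.
Proof.
move=> fc hc fh.
(* The kernel has total mass one, so the constant is itself an integral against the weight and the
   comparison becomes pointwise. *)
have -> : e = \int[mu]_(s in `[0, 1]) (3 * (1 - s) ^+ 2 * e).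
  rewrite (@Rintegral_FTC _ _ (fun s => - ((1 - s) ^+ 3 * e))).
  - by rewrite subr0 subrr; ring.
  - exact: ler01.
  - by cont.
  - by move=> s; apply: has_deriv_eq; [der|rewrite /=; ring].
have mI : measurable `[(0:R), 1] by exact: measurable_itv.
rewrite /avg -RintegralD; [|exact: mI|apply: continuous_integrable; by cont..].
apply: le_Rintegral; [exact: mI|apply: continuous_integrable; by cont..|].
move=> s; rewrite /= in_itv /= => /fh H.
have := sqr_ge0 (1 - s); nra.
Qed.

Lemma avg_cst a c x : avg a (fun _ => c) x = c.
Proof.
rewrite /avg (@Rintegral_FTC _ _ (fun s => - ((1 - s) ^+ 3 * c))).
- by rewrite subr0 subrr; ring.
- exact: ler01.
- by cont.
- by move=> s; apply: has_deriv_eq; [der|rewrite /=; field].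
Qed.

Lemma avg_ge0 a f x : (forall y, 0 <= f y) -> 0 <= avg a f x.
Proof.
move=> f0; apply: Rintegral_ge0 => s _.
by rewrite mulr_ge0 ?addr_ge0 // mulr_ge0 ?sqr_ge0 // divr_ge0.
Qed.

Lemma avg_even a f x : (forall y, f (- y) = f y) -> avg a f (- x) = avg a f x.
Proof.
move=> fe; apply: eq_Rintegral => s _; congr (_ * _).
rewrite addrC -opprD fe; congr (_ + _).
by rewrite -fe; congr f; ring.
Qed.

Lemma avg_supp a f r x : 0 <= a -> (forall y, r < `|y| -> f y = 0) ->
  r + a < `|x| -> avg a f x = 0.
Proof.
move=> a0 fr rx.
have H s : 0 <= s <= 1 -> f (x + a * s) = 0 /\ f (x - a * s) = 0.
  move=> /andP[s0 s1].
  have as_ : `|a * s| <= a by rewrite ger0_norm ?mulr_ge0 // ler_piMr.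
  split; apply: fr.
    have := ler_normB (x + a * s) (a * s); rewrite addrK; lra.
  have := ler_normD (x - a * s) (a * s); rewrite subrK; lra.
rewrite -[RHS](avg_cst a 0 x); apply: eq_Rintegral => s.
by rewrite inE /= in_itv /= => /H [-> ->].
Qed.

Lemma avg_continuous a f : 0 < a -> continuous f -> continuous (avg a f).
Proof.
move=> a0 fc.
have [P Pd] := antiderivative fc.
have [Q Qd] := antiderivative (has_deriv_continuous Pd).
have [T Td] := antiderivative (has_deriv_continuous Qd).
have Qc := has_deriv_continuous Qd; have Tc := has_deriv_continuous Td.
rewrite (_ : avg a f =
  fun x => 3 / a ^+ 3 * (T (x + a) - T (x - a)) - 6 / a ^+ 2 * Q x).
  by cont.
by apply/funext => x; exact: avgE.
Qed.

(* Every function to which this is applied vanishes outside [-1, 1]. *)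
Definition fcos w f : R := \int[mu]_(x in `[-2, 2]) (f x * cos (w * x)).

Lemma antiderivative_cst_ge f P b x y : b <= x -> b <= y ->
  (forall z, has_deriv z P (f z)) -> (forall z, b <= z -> f z = 0) -> P x = P y.
Proof.
move=> bx by_ Pd f0.
have mono x' y' : b <= x' -> x' <= y' -> P x' = P y'.
  move=> bx' xy; apply/eqP; rewrite eq_le; apply/andP; split.
    apply: (has_deriv_le xy Pd) => z /andP[xz _].
    by rewrite f0 // (le_trans bx').
  rewrite -lerN2.
  apply: (@has_deriv_le _ (fun z => - P z) (fun z => - f z) _ _ xy) => [z|z /andP[xz _]].
    exact: has_derivN.
  by rewrite f0 ?oppr0 // (le_trans bx').
by have [xy|/ltW yx] := leP x y; [exact: mono|rewrite (mono y x)].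
Qed.

Lemma antiderivative_cst_le f P b x y : x <= b -> y <= b ->
  (forall z, has_deriv z P (f z)) -> (forall z, z <= b -> f z = 0) -> P x = P y.
Proof.
move=> xb yb Pd f0; rewrite -[x]opprK -[y]opprK.
apply: (@antiderivative_cst_ge (fun z => - f (- z)) (fun z => P (- z)) (- b)).
- by rewrite lerN2.
- by rewrite lerN2.
- by move=> z; apply: has_deriv_eq; [der|rewrite /=; ring].
- by move=> z bz; rewrite f0 ?oppr0 // lerNl.
Qed.

(** The convolution theorem for this kernel, obtained from an explicit primitive rather than by
    exchanging integrals. *)
Lemma fcos_avg w a f : 0 < w -> 0 < a -> a < 1 -> continuous f ->
  (forall x, 1 < `|x| -> f x = 0) -> (forall x, 1 < `|x| -> avg a f x = 0) ->
  fcos w (avg a f) = rho (a * w) * fcos w f.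
Proof.
move=> w0 a0 a1 fc fs As.
have [wN0 aN0] : w != 0 /\ a != 0 by rewrite !gt_eqF.
have [P Pd] := antiderivative fc.
have [Q Qd] := antiderivative (has_deriv_continuous Pd).
have [T Td] := antiderivative (has_deriv_continuous Qd).
have [c cd] : exists c, forall x, has_deriv x c (f x * cos (w * x)).
  by apply: antiderivative; cont.
have [s sd] : exists s, forall x, has_deriv x s (f x * sin (w * x)).
  by apply: antiderivative; cont.
pose A x := 3 / a ^+ 3 * (T (x + a) - T (x - a)) - 6 / a ^+ 2 * Q x.
pose A1 x := 3 / a ^+ 3 * (Q (x + a) - Q (x - a)) - 6 / a ^+ 2 * P x.
have AE x : avg a f x = A x by exact: avgE.
have Ad x : has_deriv x A (A1 x).
  by rewrite /A /A1; apply: has_deriv_eq; [der|rewrite /=; field].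
(* E combines two integrations by parts of A'' cos (w x) with the translations by a
   of f sin (w x), so that E' = w^2 A cos (w x) while the boundary terms of E only
   involve c. *)
pose E x := A1 x * cos (w * x) + w * (A x * sin (w * x))
  - 3 / (a ^+ 3 * w) * ((P (x + a) - P (x - a)) * sin (w * x))
  + 3 / (a ^+ 3 * w) * (cos (w * a) * s (x + a) - sin (w * a) * c (x + a)
     - cos (w * a) * s (x - a) - sin (w * a) * c (x - a))
  + 6 / a ^+ 2 * c x.
have Ed x : has_deriv x E (w ^+ 2 * (A x * cos (w * x))).
  have d1 y : has_deriv y A1
      (3 / a ^+ 3 * (P (y + a) - P (y - a)) - 6 / a ^+ 2 * f y).
    by rewrite /A1; apply: has_deriv_eq; [der|rewrite /=; field].
  rewrite /E; apply: has_deriv_eq; first by der.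
  have e1 := sinB (w * (x + a)) (w * a); rewrite -mulrBr addrK in e1.
  have e2 := sinD (w * (x - a)) (w * a); rewrite -mulrDr subrK in e2.
  apply: (@eq_trans _ _ (w ^+ 2 * (A x * cos (w * x))
    + 3 / (a ^+ 3 * w) * (f (x + a) * (sin (w * (x + a)) * cos (w * a)
        - cos (w * (x + a)) * sin (w * a) - sin (w * x)))
    - 3 / (a ^+ 3 * w) * (f (x - a) * (sin (w * (x - a)) * cos (w * a)
        + cos (w * (x - a)) * sin (w * a) - sin (w * x))))).
    by rewrite /= /A1; field; rewrite ?wN0 ?aN0.
  by rewrite -e1 -e2; ring.
have Ac := has_deriv_continuous Ad.
(* As [a < 1], the threshold [2 - a] exceeds 1, so the translates by [a] of the end points of
   [-2, 2] stay where [f] vanishes. *)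
have fr z : 2 - a <= z -> f z = 0 by move=> az; apply: fs; rewrite gtr0_norm; lra.
have fl z : z <= - (2 - a) -> f z = 0 by move=> az; apply: fs; rewrite ltr0_norm; lra.
have cr z : 2 - a <= z -> f z * cos (w * z) = 0 by move=> /fr ->; rewrite mul0r.
have cl z : z <= - (2 - a) -> f z * cos (w * z) = 0 by move=> /fl ->; rewrite mul0r.
have sr z : 2 - a <= z -> f z * sin (w * z) = 0 by move=> /fr ->; rewrite mul0r.
have sl z : z <= - (2 - a) -> f z * sin (w * z) = 0 by move=> /fl ->; rewrite mul0r.
(* To the right of the support [P], [c] and [s] are constant, hence [Q] is affine with slope
   [P 2]. *)
have right y : 2 - a <= y -> [/\ P y = P 2, c y = c 2, s y = s 2 & Q y - y * P 2 = Q 2 - 2 * P 2].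
  move=> ay; have a2 : 2 - a <= 2 by lra.
  split; [exact: antiderivative_cst_ge Pd fr|exact: antiderivative_cst_ge cd cr|exact: antiderivative_cst_ge sd sr|].
  apply: (@antiderivative_cst_ge (fun z => P z - P 2) (fun z => Q z - z * P 2) (2 - a)) => //.
    by move=> z; apply: has_deriv_eq; [der|rewrite /=; ring].
  by move=> z az; rewrite (antiderivative_cst_ge az a2 Pd fr) subrr.
have left y : y <= - (2 - a) -> [/\ P y = P (- 2), c y = c (- 2), s y = s (- 2) &
    Q y - y * P (- 2) = Q (- 2) + 2 * P (- 2)].
  move=> ay; have a2 : - 2 <= - (2 - a) by lra.
  split; [exact: antiderivative_cst_le Pd fl|exact: antiderivative_cst_le cd cl|
    exact: antiderivative_cst_le sd sl|].
  have -> : Q (- 2) + 2 * P (- 2) = Q (- 2) - - 2 * P (- 2) by ring.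
  apply: (@antiderivative_cst_le (fun z => P z - P (- 2)) (fun z => Q z - z * P (- 2)) (- (2 - a))) => //.
    by move=> z; apply: has_deriv_eq; [der|rewrite /=; ring].
  by move=> z az; rewrite (antiderivative_cst_le az a2 Pd fl) subrr.
have k : w ^+ 2 * fcos w (avg a f) = E 2 - E (- 2).
  rewrite -(@Rintegral_FTC _ _ E (- 2) 2 _ _ Ed); [|lra|by cont].
  rewrite /fcos -RintegralZl; first by apply: eq_Rintegral => x _; rewrite AE.
    exact: measurable_itv.
  apply: continuous_integrable; have avgc := avg_continuous a0 fc; by cont.
have n2 : 1 < `|2 : R| by rewrite ger0_norm // ltr1n.
have A2 : A 2 = 0 by rewrite -AE As.
have AN2 : A (- 2) = 0 by rewrite -AE As // normrN.
have [P1 c1 s1 Q1] := right (2 + a) ltac:(lra).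
have [P2 c2 s2 Q2] := right (2 - a) ltac:(lra).
have [P3 c3 s3 Q3] := left (- 2 + a) ltac:(lra).
have [P4 c4 s4 Q4] := left (- 2 - a) ltac:(lra).
have fE : fcos w f = c 2 - c (- 2).
  by rewrite /fcos (Rintegral_FTC _ _ cd); [|lra|by cont].
(* The affine form of [Q] makes its difference across 2 equal to [2 * a * P 2], which cancels the
   last term of [A1]. *)
have A12 : A1 2 = 0.
  have -> : A1 2 = 3 / a ^+ 3 * ((Q (2 + a) - (2 + a) * P 2) - (Q (2 - a) - (2 - a) * P 2)).
    by rewrite /A1; field.
  by rewrite Q1 Q2 subrr mulr0.
have A1N2 : A1 (- 2) = 0.
  have -> : A1 (- 2) = 3 / a ^+ 3 * ((Q (- 2 + a) - (- 2 + a) * P (- 2))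
     - (Q (- 2 - a) - (- 2 - a) * P (- 2))).
    by rewrite /A1; field.
  by rewrite Q3 Q4 subrr mulr0.
have w2N0 : w ^+ 2 != 0 by rewrite expf_neq0.
(* In [E 2 - E (- 2)] the terms in [P] and [s] cancel. Those in [c] leave the coefficient [6 / a ^+
   2 - 6 * sin (w * a) / (a ^+ 3 * w)], which is [w ^+ 2 * rho (a * w)]. *)
apply: (mulfI w2N0); rewrite k fE /E A2 AN2 A12 A1N2.
rewrite P1 P2 P3 P4 c1 c2 c3 c4 s1 s2 s3 s4 /rho [a * w]mulrC.
by field; rewrite wN0 aN0.
Qed.

End Averaging.

(** * The Lipschitz bump that starts the convolution *)

Section Tent.
Set Implicit Arguments.
Unset Strict Implicit.
Unset Printing Implicit Defensive.
Context {R : realType}.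
Implicit Types (b w x y : R).
Local Notation mu := (@lebesgue_measure R).

Lemma fcos_even w (f : R -> R) (c : R -> R) : continuous f ->
  (forall x, f (- x) = f x) -> (forall x, has_deriv x c (f x * cos (w * x))) ->
  fcos w f = 2 * (c 2 - c 0).
Proof.
move=> fc fe cd.
have H : c 2 + c (- 2) = c 0 + c (- 0).
  apply: (@has_deriv_eq0_cst _ (fun x => c x + c (- x))) => x.
  apply: has_deriv_eq; first by der.
  by rewrite /= fe (mulrN w x) cosN; ring.
rewrite oppr0 in H.
rewrite /fcos (Rintegral_FTC _ _ cd); [|lra|by cont].
lra.
Qed.

(** This is the kernel of [avg b] itself, a squared tent of mass one, so its cosine integral is
    again a value of [rho]. *)
Definition tent b x : R := 3 / (2 * b) * Num.max 0 (1 - `|x| / b) ^+ 2.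

Lemma tent_ge0 b x : 0 < b -> 0 <= tent b x.
Proof. by move=> b0; rewrite mulr_ge0 ?sqr_ge0 // divr_ge0 // mulr_ge0 // ltW. Qed.

Lemma tent_even b x : tent b (- x) = tent b x.
Proof. by rewrite /tent normrN. Qed.

Lemma tent_supp b x : 0 < b -> b <= `|x| -> tent b x = 0.
Proof.
move=> b0 bx; rewrite /tent max_l ?expr0n ?mulr0 //.
by rewrite subr_le0 ler_pdivlMr // mul1r.
Qed.

Lemma tent_lipschitz b x y : 0 < b -> `|tent b x - tent b y| <= 3 / b ^+ 2 * `|x - y|.
Proof.
move=> b0; rewrite /tent -mulrBr normrM ger0_norm; last first.
  by rewrite divr_ge0 // mulr_ge0 // ltW.
set m1 := Num.max _ _; set m2 := Num.max _ _.
have m01 (z : R) : 0 <= Num.max 0 (1 - `|z| / b) <= 1.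
  rewrite le_max lexx /= ge_max ler01 /= gerBl.
  by rewrite divr_ge0 // ltW.
have /andP[m10 m11] : 0 <= m1 <= 1 by exact: m01.
have /andP[m20 m21] : 0 <= m2 <= 1 by exact: m01.
have d : `|m1 - m2| <= `|x - y| / b.
  have nxy : `|(1 - `|x| / b) - (1 - `|y| / b)| <= `|x - y| / b.
    rewrite (_ : _ - _ = (`|y| - `|x|) / b); last by ring.
    rewrite normrM (@ger0_norm _ b^-1) ?invr_ge0 ?(ltW b0) //.
    by rewrite ler_wpM2r ?invr_ge0 ?(ltW b0) // (distrC x); exact: ler_dist_dist.
  apply: le_trans nxy; rewrite /m1 /m2.
  move: (1 - _) (1 - _) => u v.
  have [hu|/ltW hu] := leP 0 u; have [hv|/ltW hv] := leP 0 v => //.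
  - by rewrite sub0r normrN ger0_norm // ler0_norm; lra.
  - by rewrite subr0 !ger0_norm; lra.
  - by rewrite subrr normr0.
clearbody m1 m2; rewrite subr_sqr normrM.
have s2 : `|m1 + m2| <= 2 by rewrite ger0_norm; lra.
apply: (@le_trans _ _ (3 / (2 * b) * ((`|x - y| / b) * 2))).
  rewrite ler_wpM2l ?divr_ge0 ?mulr_ge0 ?(ltW b0) //.
  exact: ler_pM.
rewrite le_eqVlt; apply/orP; left; apply/eqP; field; rewrite gt_eqF //.
Qed.

Lemma lipschitz_continuous (f : R -> R) L :
  (forall x y, `|f x - f y| <= L * `|x - y|) -> continuous f.
Proof.
move=> fL x; apply/cvgrPdist_le => e e0.
pose M := `|L| + 1; have M0 : 0 < M by rewrite /M; have := normr_ge0 L; lra.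
near=> y; apply: le_trans (fL _ _) _.
have xy : `|x - y| <= e / M.
  by near: y; apply: (@cvgr_dist_le _ _ _ _ _ id) => //; exact: divr_gt0.
have := ler_norm L; have := normr_ge0 (x - y).
rewrite ler_pdivlMr // in xy; move: xy; rewrite /M; nra.
Unshelve. all: by end_near. Qed.

Lemma tent_continuous b : 0 < b -> continuous (tent b).
Proof.
by move=> b0; apply: (@lipschitz_continuous _ (3 / b ^+ 2)) => x y; exact: tent_lipschitz.
Qed.

Lemma fcos_tent b w : 0 < w -> 0 < b <= 1 -> fcos w (tent b) = rho (b * w).
Proof.
move=> w0 /andP[b0 b1]; have [wN0 bN0] : w != 0 /\ b != 0 by rewrite !gt_eqF.
have tc := tent_continuous b0.
have [c cd] : exists c, forall x, has_deriv x c (tent b x * cos (w * x)).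
  by apply: antiderivative; cont.
rewrite (fcos_even tc (tent_even b) cd).
have -> : c 2 = c b.
  apply: (antiderivative_cst_ge _ (lexx b) cd); first lra.
  by move=> z bz; rewrite tent_supp ?mul0r // ger0_norm // (le_trans (ltW b0)).
rewrite -(Rintegral_FTC (ltW b0) _ cd); last by cont.
have -> : \int[mu]_(x in `[0, b]) (tent b x * cos (w * x)) =
    \int[mu]_(x in `[0, b]) (3 / (2 * b) * (1 - x / b) ^+ 2 * cos (w * x)).
  apply: eq_Rintegral => x; rewrite inE /= in_itv /= => /andP[x0 xb].
  rewrite /tent ger0_norm // max_r //.
  by rewrite subr_ge0 ler_pdivrMr // mul1r.
rewrite (@Rintegral_FTC _ _ (fun x => 3 / (2 * b) * ((1 - x / b) ^+ 2 * (sin (w * x) / w)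
  - 2 / (b * w ^+ 2) * ((1 - x / b) * cos (w * x)) - 2 / (b ^+ 2 * w ^+ 3) * sin (w * x)))).
- rewrite mulr0 sin0 cos0 divff // /rho [b * w]mulrC; field.
  by rewrite ?wN0 ?bN0.
- exact: ltW.
- by cont.
- move=> x; apply: has_deriv_eq; [der|rewrite /=; field].
  by rewrite ?wN0 ?bN0.
Qed.

End Tent.

(** * Regularity gained by averaging *)

Section Smoothness.
Set Implicit Arguments.
Unset Strict Implicit.
Unset Printing Implicit Defensive.
Context {R : realType}.
Implicit Types (f g P : R -> R) (a c x : R) (n : nat).

(** The derivative is existentially quantified, so that closure properties go by induction on [n]
    with explicit candidates; iterated derivatives appear only in [class_C_smooth]. *)
Fixpoint class_C n f : Prop :=
  if n is n'.+1 then exists2 f', (forall x, has_deriv x f (f' x)) & class_C n' f'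
  else continuous f.

Lemma class_CS n f : class_C n.+1 f -> class_C n f.
Proof.
elim: n f => [|n IHn] f [f' fd f'C]; first exact: has_deriv_continuous fd.
by exists f' => //; exact: IHn.
Qed.

Lemma class_CD n f g : class_C n f -> class_C n g -> class_C n (fun x => f x + g x).
Proof.
elim: n f g => [|n IHn] f g; first exact: contD.
move=> [f' fd f'C] [g' gd g'C]; exists (fun x => f' x + g' x); last exact: IHn.
by move=> x; apply: has_derivD.
Qed.

Lemma class_CZ n c f : class_C n f -> class_C n (fun x => c * f x).
Proof.
elim: n f => [|n IHn] f; first by move=> /= fc; cont.
move=> [f' fd f'C]; exists (fun x => c * f' x); last exact: IHn.
by move=> x; apply: has_deriv_eq; [der|rewrite /=; ring].
Qed.

Lemma class_C_shift n a f : class_C n f -> class_C n (fun x => f (x + a)).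
Proof.
elim: n f => [|n IHn] f; first by move=> /= fc; cont.
move=> [f' fd f'C]; exists (fun x => f' (x + a)); last exact: IHn.
by move=> x; apply: has_deriv_eq; [der|rewrite /=; ring].
Qed.

(** By [avgE] the average is built from second and third antiderivatives of [f]. One order gained
    per averaging is enough for the bootstrap on the limit. *)
Lemma class_C_avg n a f : 0 < a -> class_C n f -> class_C n.+1 (avg a f).
Proof.
move=> a0 fC; have fc : continuous f by elim: n fC => [//|n IHn] /class_CS /IHn.
have [P Pd] := antiderivative fc.
have [Q Qd] := antiderivative (has_deriv_continuous Pd).
have [T Td] := antiderivative (has_deriv_continuous Qd).
have PC : class_C n.+1 P by exists f.
have QC : class_C n.+2 Q by exists P.
have TC : class_C n.+3 T by exists Q.
rewrite (_ : avg a f = fun x =>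
  3 / a ^+ 3 * (T (x + a) + -1 * T (x + - a)) + - (6 / a ^+ 2) * Q x); last first.
  by apply/funext => x; rewrite (avgE x a0 fc Pd Qd Td) mulN1r mulNr.
apply: class_CD; apply: class_CZ; last exact: class_CS.
apply: class_CD; last apply: class_CZ; apply: class_C_shift; do 2 apply: class_CS; exact: TC.
Qed.

Lemma class_C_smooth f : (forall n, class_C n f) -> smooth f.
Proof.
move=> fC n; move: (fC n.+1); elim: n f {fC} => [|n IHn] f [f' fd f'C] x.
  by have [] := fd x.
rewrite derive1Sn (_ : (f^`())%classic = f'); last first.
  by apply/funext => y; rewrite derive1E; have [_ ->] := fd y.
exact: IHn.
Qed.

End Smoothness.

(** * Uniform limits of iterated convolutions *)

Section InfiniteConvolution.
Set Implicit Arguments.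
Unset Strict Implicit.
Unset Printing Implicit Defensive.
Context {R : realType}.
Implicit Types (f h : R -> R) (e w x y : R) (m n : nat).
Local Notation mu := (@lebesgue_measure R).

Lemma avg_dist a e f h x : continuous f -> continuous h ->
  (forall y, `|f y - h y| <= e) -> `|avg a f x - avg a h x| <= e.
Proof.
move=> fc hc fh.
have fh' y : f y <= h y + e /\ h y <= f y + e.
  by have := fh y; rewrite ler_norml; lra.
rewrite ler_norml; apply/andP; split.
  suff : avg a h x <= avg a f x + e by lra.
  by apply: le_avg => // s _; have [_ A] := fh' (x + a * s); have [_ B] := fh' (x - a * s); lra.
suff : avg a f x <= avg a h x + e by lra.
by apply: le_avg => // s _; have [A _] := fh' (x + a * s); have [B _] := fh' (x - a * s); lra.
Qed.

Lemma fcos_dist w e f h : continuous f -> continuous h ->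
  (forall y, `|f y - h y| <= e) -> `|fcos w f - fcos w h| <= 4 * e.
Proof.
move=> fc hc fh.
have mI : measurable `[(- 2 : R), 2] by exact: measurable_itv.
rewrite /fcos -RintegralB; [|exact: mI|apply: continuous_integrable; by cont..].
apply: le_trans (le_normr_Rintegral _ _) _ => //.
  by apply: continuous_integrable; cont.
have -> : 4 * e = \int[mu]_(x in `[- 2, 2]) e.
  rewrite (@Rintegral_FTC _ _ (fun s => e * s)).
  - by ring.
  - lra.
  - by cont.
  - by move=> s; apply: has_deriv_eq; [der|rewrite /=; ring].
apply: le_Rintegral => //.
- apply: integrable_norm; apply: (@continuous_integrable _ (fun x => f x * cos (w * x) - h x * cos (w * x))); by cont.
- by apply: continuous_integrable; cont.
move=> x _; rewrite -mulrBl normrM.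
apply: le_trans (fh x); rewrite ler_piMr //.
by rewrite ler_norml cos_geN1 cos_le1.
Qed.

(** [tau n] stands for a bound on the tail sum of the widths from [a n] on. The telescoping
    inequality and the limit 0 express summability, and [tau] controls both the supports and the
    rate of convergence. *)
Variables (a tau : nat -> R) (f0 : R -> R) (r0 L : R).
Hypothesis a_gt0 : forall n, 0 < a n.
Hypothesis a_lt1 : forall n, a n < 1.
Hypothesis tau_step : forall n, a n <= tau n - tau n.+1.
Hypothesis tau_cvg : tau n @[n --> \oo] --> (0 : R).
Hypothesis f0_lip : forall x y, `|f0 x - f0 y| <= L * `|x - y|.
Hypothesis f0_ge0 : forall x, 0 <= f0 x.
Hypothesis f0_even : forall x, f0 (- x) = f0 x.
Hypothesis f0_supp : forall x, r0 < `|x| -> f0 x = 0.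
Hypothesis r0_tau : r0 + tau 0%N <= 1.

Lemma tau_ge0 n : 0 <= tau n.
Proof.
have tm : nonincreasing_seq tau.
  apply/nonincreasing_seqP => k; have := tau_step k; have := a_gt0 k; lra.
by rewrite -(cvg_lim _ tau_cvg) //; apply: nonincreasing_cvgn_ge => //; apply: cvgP tau_cvg.
Qed.

Lemma L_ge0 : 0 <= L.
Proof. by have := f0_lip 0 1; rewrite sub0r normrN1 mulr1; exact: le_trans. Qed.

(** The smallest index is outermost and the offset [m] is a parameter, so that the recursion
    survives in the limit as [conv_limitE]. *)
Fixpoint conv n m : R -> R := if n is n'.+1 then avg (a m) (conv n' m.+1) else f0.

Lemma conv_continuous n m : continuous (conv n m).
Proof.
elim: n m => [|n IHn] m /=; first exact: lipschitz_continuous f0_lip.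
exact: avg_continuous.
Qed.

Lemma conv_ge0 n m x : 0 <= conv n m x.
Proof. by elim: n m x => [|n IHn] m x //=; exact: avg_ge0. Qed.

Lemma conv_even n m x : conv n m (- x) = conv n m x.
Proof. by elim: n m x => [|n IHn] m x //=; exact: avg_even. Qed.

Lemma conv_supp n m x : r0 + tau m < `|x| -> conv n m x = 0.
Proof.
elim: n m x => [|n IHn] m x /= rx.
  by apply: f0_supp; have := tau_ge0 m; lra.
apply: (avg_supp (ltW (a_gt0 m)) (IHn m.+1)).
by have := tau_step m; lra.
Qed.

Lemma tau_le m : tau m <= tau 0%N.
Proof. by elim: m => // m IHm; have := tau_step m; have := a_gt0 m; lra. Qed.

Lemma conv_supp1 n m x : 1 < `|x| -> conv n m x = 0.
Proof. by move=> x1; apply: conv_supp; have := tau_le m; have := r0_tau; lra. Qed.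

Lemma avg_f0_dist m x : `|avg (a m) f0 x - f0 x| <= L * a m.
Proof.
have fc := lipschitz_continuous f0_lip.
have am := a_gt0 m.
have H s : 0 <= s <= 1 -> `|f0 (x + a m * s) - f0 x| <= L * a m /\
                          `|f0 (x - a m * s) - f0 x| <= L * a m.
  move=> /andP[s0 s1].
  have as_ : `|a m * s| <= a m.
    by rewrite ger0_norm ?mulr_ge0 ?(ltW am) // ler_piMr // ltW.
  split; apply: le_trans (f0_lip _ _) _; rewrite ler_wpM2l ?L_ge0 //.
    by rewrite addrAC subrr add0r.
  by rewrite addrAC subrr add0r normrN.
have cc : continuous (fun _ : R => f0 x) by cont.
rewrite ler_norml; apply/andP; split.
  suff : avg (a m) (fun _ => f0 x) x <= avg (a m) f0 x + L * a m by rewrite avg_cst; lra.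
  by apply: le_avg => // s /H; rewrite !ler_norml; lra.
suff : avg (a m) f0 x <= avg (a m) (fun _ => f0 x) x + L * a m by rewrite avg_cst; lra.
by apply: le_avg => // s /H; rewrite !ler_norml; lra.
Qed.

(** The two functions differ only in the innermost average of [f0], which moves it by at most L
    times the width; the outer averages do not increase uniform distances. *)
Lemma conv_step n m x : `|conv n.+1 m x - conv n m x| <= L * tau (n + m)%N - L * tau (n.+1 + m)%N.
Proof.
elim: n m x => [|n IHn] m x.
  rewrite add0n add1n /= -mulrBr; apply: le_trans (avg_f0_dist _ _) _.
  by rewrite ler_wpM2l ?L_ge0.
rewrite 2!addSnnS; apply: avg_dist; [exact: (@conv_continuous n.+1)|exact: conv_continuous|exact: IHn].
Qed.

Definition conv_limit m x : R := lim (conv n m x @[n --> \oo]).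

Lemma Ltau_cvg m c : c + L * tau (n + m)%N @[n --> \oo] --> c.
Proof.
rewrite -[X in _ --> X]addr0; apply: cvgD; first exact: cvg_cst.
rewrite -[X in _ --> X](mulr0 L); apply: cvgM; first exact: cvg_cst.
by rewrite (@cvg_shiftn m _ tau).
Qed.

(** By [conv_step], adding [L * tau (n + m)] makes the sequence nonincreasing; it is bounded below
    by 0, and the added term tends to 0. *)
Lemma conv_cvg m x : conv n m x @[n --> \oo] --> conv_limit m x.
Proof.
have : cvgn (fun n => conv n m x + L * tau (n + m)%N).
  apply: nonincreasing_is_cvgn.
    apply/nonincreasing_seqP => n; have := conv_step n m x.
    by rewrite ler_norml; lra.
  exists 0 => _ [n _ <-]; rewrite addr_ge0 ?conv_ge0 // mulr_ge0 ?L_ge0 //.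
  exact: tau_ge0.
move=> Hc; suff : cvgn (fun n => conv n m x) by [].
rewrite (_ : (fun n => conv n m x) = (fun n => conv n m x + L * tau (n + m)%N)
    \- (fun n => 0 + L * tau (n + m)%N)); last by apply/funext => n /=; ring.
exact: is_cvgB Hc (cvgP _ (@Ltau_cvg m 0)).
Qed.

Lemma conv_limit_dist n m x : `|conv_limit m x - conv n m x| <= L * tau (n + m)%N.
Proof.
have dist k : (n <= k)%N -> `|conv k m x - conv n m x| <= L * tau (n + m)%N - L * tau (k + m)%N.
  move=> /subnK <-; elim: (k - n)%N => [|j IHj].
    by rewrite add0n !subrr normr0.
  have := conv_step (j + n) m x; move: IHj; rewrite !ler_norml addSn; lra.
have Lt k : 0 <= L * tau k by rewrite mulr_ge0 ?L_ge0 ?tau_ge0.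
rewrite ler_norml; apply/andP; split.
  rewrite lerBrDr; apply: (cvgr_to_ge (@conv_cvg m x)).
  near=> k; have nk : (n <= k)%N by near: k; exact: nbhs_infty_ge.
  have := dist k nk; rewrite ler_norml; have := Lt (k + m)%N; lra.
rewrite lerBlDr; apply: (cvgr_to_le (@conv_cvg m x)).
near=> k; have nk : (n <= k)%N by near: k; exact: nbhs_infty_ge.
have := dist k nk; rewrite ler_norml; have := Lt (k + m)%N; lra.
Unshelve. all: by end_near. Qed.

Lemma Ltau_small m e : 0 < e -> exists n, L * tau (n + m)%N <= e.
Proof.
move=> e0; have /cvgrPdist_le /(_ e e0) [n _ H] := @Ltau_cvg m 0.
exists n; have := H n (leqnn n).
by rewrite /= sub0r normrN add0r; exact: le_trans (ler_norm _).
Qed.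

Lemma conv_limit_continuous m : continuous (conv_limit m).
Proof.
move=> x; apply/cvgrPdist_le => e e0.
have [|n ne] := @Ltau_small m (e / 3); first by rewrite divr_gt0.
near=> y.
have xy : `|conv n m x - conv n m y| <= e / 3.
  near: y; apply: (@cvgr_dist_le _ _ _ _ _ (conv n m)); last by rewrite divr_gt0.
  exact: conv_continuous.
have := conv_limit_dist n m x; have := conv_limit_dist n m y.
move: xy ne; rewrite !ler_norml; lra.
Unshelve. all: by end_near. Qed.

Lemma conv_limitE m : conv_limit m = avg (a m) (conv_limit m.+1).
Proof.
apply/funext => x; apply/eqP; rewrite -subr_eq0 -normr_le0; apply/ler_addgt0Pl => e e0.
rewrite addr0; have [|n ne] := @Ltau_small m.+1 (e / 2); first by rewrite divr_gt0.
have H1 := conv_limit_dist n.+1 m x.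
have H2 : `|avg (a m) (conv n m.+1) x - avg (a m) (conv_limit m.+1) x| <= e / 2.
  apply: avg_dist; [exact: conv_continuous|exact: conv_limit_continuous|].
  by move=> y; rewrite distrC; apply: le_trans (conv_limit_dist _ _ _) ne.
move: ne H1 H2; rewrite addSnnS /= !ler_norml; lra.
Qed.

Lemma conv_limit_ge0 m x : 0 <= conv_limit m x.
Proof. by apply: (cvgr_to_ge (@conv_cvg m x)); near=> n; exact: conv_ge0.
Unshelve. all: by end_near. Qed.

Lemma conv_limit_even m x : conv_limit m (- x) = conv_limit m x.
Proof.
rewrite /conv_limit (_ : (fun n => conv n m (- x)) = (fun n => conv n m x)) //.
by apply/funext => n; exact: conv_even.
Qed.

Lemma conv_limit_supp m x : 1 < `|x| -> conv_limit m x = 0.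
Proof.
move=> x1; rewrite /conv_limit (_ : (fun n => _) = (fun _ => 0)) ?lim_cst //.
by apply/funext => n; exact: conv_supp1.
Qed.

(** Bootstrap: each limit is an average of the next one, so the induction on the order must run over
    all offsets at once. *)
Lemma conv_limit_smooth m : smooth (conv_limit m).
Proof.
apply: class_C_smooth => n; elim: n m => [|n IHn] m; first exact: conv_limit_continuous.
by rewrite conv_limitE; exact: class_C_avg.
Qed.

Lemma fcos_conv w n m : 0 < w ->
  fcos w (conv n m) = (\prod_(i < n) rho (a (i + m)%N * w)) * fcos w f0.
Proof.
move=> w0; elim: n m => [|n IHn] m /=; first by rewrite big_ord0 mul1r.
rewrite fcos_avg //; last 3 first.
- exact: conv_continuous.
- exact: conv_supp1.
- exact: (@conv_supp1 n.+1 m).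
rewrite IHn mulrA big_ord_recl add0n; congr (_ * _ * _).
by apply: eq_bigr => i _; rewrite addSnnS.
Qed.

Lemma fcos_conv_limit w : 0 < w ->
  (\prod_(i < n) rho (a i * w)) * fcos w f0 @[n --> \oo] --> fcos w (conv_limit 0).
Proof.
move=> w0; apply/cvgrPdist_le => e e0.
have [|n0 ne] := @Ltau_small 0 (e / 4); first by rewrite divr_gt0.
near=> n.
have -> : (\prod_(i < n) rho (a i * w)) * fcos w f0 = fcos w (conv n 0).
  by rewrite fcos_conv //; congr (_ * _); apply: eq_bigr => i _; rewrite addn0.
(* The factor 4 is the length of the integration interval [-2, 2]. *)
have -> : e = 4 * (e / 4) by field.
apply: fcos_dist; [exact: conv_limit_continuous|exact: conv_continuous|].
move=> y; apply: le_trans (conv_limit_dist _ _ _) _.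
apply: le_trans ne; rewrite ler_wpM2l ?L_ge0 // !addn0.
have nn : (n0 <= n)%N by near: n; exact: nbhs_infty_ge.
move: nn => /subnK <-; elim: (n - n0)%N => // j; rewrite addSn => H.
by have := tau_step (j + n0); have := a_gt0 (j + n0); lra.
Unshelve. all: by end_near. Qed.

End InfiniteConvolution.

(** * Linear growth of the exponent sums *)

Section Asymptotics.
Set Implicit Arguments.
Unset Strict Implicit.
Unset Printing Implicit Defensive.
Context {R : realType}.
Implicit Types (t u x y e : R) (n m : nat).
Variable p : R.
Hypothesis p_gt1 : 1 < p.

(** The exponent contributed by one kernel: for x = (c w)^(1/p), the width c j^(-p) gives [rho] the
    argument c j^(-p) w = (x / j)^p. *)
Definition theta t : R := - ln (rho (t `^ p)).

Definition theta_sum n x : R := \sum_(i < n) theta (x / i.+1%:R).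

(* This relies on the junk values rho 0 = 0 and ln 0 = 0. *)
Lemma theta0 : theta 0 = 0.
Proof.
rewrite /theta powR0; last by rewrite gt_eqF // (lt_trans ltr01).
by rewrite /rho sin0 subrr mulr0 mul0r ln0 // oppr0.
Qed.

Lemma theta_ge0 t : 0 <= t -> 0 <= theta t.
Proof.
rewrite le_eqVlt => /predU1P[<-|t0]; first by rewrite theta0.
by rewrite oppr_ge0 ln_le0 // rho_le1 // powR_gt0.
Qed.

Lemma theta_le t u : 0 <= t -> t <= u -> theta t <= theta u.
Proof.
rewrite le_eqVlt => /predU1P[<- u0|t0 tu]; first by rewrite theta0 theta_ge0.
have u0 : 0 < u by apply: lt_le_trans tu.
have tp := powR_gt0 p t0; have up := powR_gt0 p u0.
rewrite lerN2 ler_ln ?posrE ?rho_gt0 //; apply: rho_nonincreasing => //.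
by apply: ge0_ler_powR; rewrite ?nnegrE ?(ltW t0) ?(ltW u0) ?(ltW (lt_trans ltr01 p_gt1)).
Qed.

Lemma theta_le_ln t : 0 < t -> theta t <= ln (1 + (t `^ p) ^+ 2).
Proof.
move=> t0; have tp := powR_gt0 p t0.
have pos : 0 < 1 + (t `^ p) ^+ 2 by rewrite ltr_wpDr ?sqr_ge0.
rewrite /theta lerNl -lnV ?posrE // ler_ln ?posrE ?invr_gt0 ?rho_gt0 //.
exact: rho_lower.
Qed.

(** The majorant is of order t^(3/2) at 0 and t^(1/2) at infinity, between the quadratic and
    logarithmic behaviour of [theta] and what the sum over t = x / j tolerates. Its shape is chosen
    to telescope in [theta_sum_bound]. *)
Lemma theta_bound : exists2 M, 0 < M & forall t, 0 < t ->
  theta t <= M * (Num.sqrt t ^+ 3 / (2 * (1 + Num.sqrt t) ^+ 2)).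
Proof.
(* The 8 bounds [2 * (1 + q) ^+ 2] for [q <= 1], and its quotient by [q ^+ 2] for [q >= 1]. The
   other factor comes from ln 2 + 4 p ln q <= (1 + 4 p) q for [q >= 1]. *)
pose M := 8 * (1 + 4 * p); exists M; first by rewrite /M; have := p_gt1; lra.
move=> t t0; set q := Num.sqrt t.
have q0 : 0 < q by rewrite sqrtr_gt0.
have tq : t = q ^+ 2 by rewrite sqr_sqrtr // ltW.
have D0 : 0 < 2 * (1 + q) ^+ 2 by rewrite mulr_gt0 // exprn_gt0 // addr_gt0.
have p1 := p_gt1.
apply: le_trans (theta_le_ln t0) _; rewrite mulrA ler_pdivlMr //.
have v0 := powR_gt0 p t0; have [t1|t1] := leP t 1.
  have q1 : q <= 1 by rewrite -sqrtr1 ler_sqrt.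
  have vt : t `^ p <= t by apply: ge1r_powR; rewrite ?t0 ?t1 // ltW.
  have l : ln (1 + (t `^ p) ^+ 2) <= q ^+ 4.
    apply: le_trans (le_ln1Dx _) _; first by apply: lt_le_trans (sqr_ge0 _); lra.
    rewrite (_ : q ^+ 4 = t ^+ 2); last by rewrite tq -exprM.
    by rewrite lerXn2r ?nnegrE ?(ltW v0) ?(ltW t0).
  apply: (@le_trans _ _ (q ^+ 4 * (2 * (1 + q) ^+ 2))); first by rewrite ler_wpM2r ?(ltW D0).
  have -> : q ^+ 4 * (2 * (1 + q) ^+ 2) = q ^+ 3 * (q * (2 * (1 + q) ^+ 2)) by ring.
  rewrite (mulrC M) ler_wpM2l ?exprn_ge0 ?(ltW q0) //.
  apply: (@le_trans _ _ 8); last by rewrite /M; lra.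
  have : (1 + q) ^+ 2 <= 2 ^+ 2 by rewrite lerXn2r ?nnegrE //; lra.
  move=> h; apply: (@le_trans _ _ (1 * (2 * 2 ^+ 2))); last lra.
  by apply: ler_pM; rewrite ?(ltW D0) ?(ltW q0) // ler_wpM2l.
have q1 : 1 <= q by rewrite -sqrtr1 ler_sqrt // ltW.
have v1 : 1 <= t `^ p.
  by apply: le_trans (ltW t1) _; apply: le1r_powR; exact: ltW.
have l : ln (1 + (t `^ p) ^+ 2) <= (1 + 4 * p) * q.
  apply: (@le_trans _ _ (ln (2 * (t `^ p) ^+ 2))).
    rewrite ler_ln ?posrE ?ltr_wpDr ?sqr_ge0 //; last by rewrite mulr_gt0 // exprn_gt0.
    have : 1 <= (t `^ p) ^+ 2 by rewrite exprn_ege1.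
    lra.
  rewrite lnM ?posrE ?exprn_gt0 // lnXn // ln_powR tq lnXn //.
  have := ln_sublinear q0; have : ln 2 <= 1 :> R.
    have := @le_ln1Dx R 1; rewrite (_ : 1 + 1 = 2); last by ring.
    by apply; lra.
  move: (ln q) (ln 2) => lq l2 h2 hq.
  have pq : p * lq <= p * q by rewrite ler_wpM2l // ltW // (lt_trans ltr01).
  lra.
apply: (@le_trans _ _ ((1 + 4 * p) * q * (2 * (1 + q) ^+ 2))); first by rewrite ler_wpM2r ?(ltW D0).
have -> : M * q ^+ 3 = (1 + 4 * p) * q * (8 * q ^+ 2) by rewrite /M; ring.
rewrite ler_wpM2l //.
  by rewrite mulr_ge0 ?(ltW q0) //; lra.
have : (1 + q) ^+ 2 <= (2 * q) ^+ 2 by rewrite lerXn2r ?nnegrE //; lra.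
by rewrite exprMn; lra.
Qed.

Lemma theta_sum_le0 n m x : 0 <= x -> (n <= m)%N -> theta_sum n x <= theta_sum m x.
Proof.
move=> x0 /subnK <-; elim: (m - n)%N => // k; rewrite addSn => /le_trans; apply.
by rewrite /theta_sum big_ord_recr /= lerDl theta_ge0 // divr_ge0.
Qed.

(* With s_j = sqrt (j / x), the bound of theta (x / j) is dominated by the increment of
   M x s / (1 + s) between s_(j-1) and s_j. *)
Lemma theta_sum_bound : exists M, forall n x, 0 < x -> theta_sum n x <= M * x.
Proof.
have [M M_gt0 Mb] := theta_bound; exists M => n x x0; pose s j : R := Num.sqrt (j%:R / x).
have s0 j : 0 <= s j by exact: sqrtr_ge0.
have sq j : s j ^+ 2 = j%:R / x by rewrite sqr_sqrtr // divr_ge0 // ltW.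
suff H : theta_sum n x <= M * x * (s n / (1 + s n)).
  apply: le_trans H _; rewrite ler_piMr ?mulr_ge0 ?(ltW M_gt0) ?(ltW x0) //.
  by have := s0 n => sn0; rewrite ler_pdivrMr; lra.
elim: n => [|n IHn]; first by rewrite /theta_sum big_ord0 !mulr_ge0 ?invr_ge0 ?addr_ge0 ?(ltW M_gt0) ?(ltW x0).
rewrite /theta_sum big_ord_recr /= -/(theta_sum n x).
have xn : 0 < x / n.+1%:R by rewrite divr_gt0.
have := Mb _ xn.
have -> : Num.sqrt (x / n.+1%:R) = (s n.+1)^-1.
  by rewrite /s -sqrtrV ?divr_ge0 ?(ltW x0) // invf_div.
move: (s0 n) (sq n) (s0 n.+1) (sq n.+1) IHn.
have : 0 < s n.+1 by rewrite sqrtr_gt0 divr_gt0.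
move: (s n) (s n.+1) => u v v0 u0 su _ sv IHn th.
have x1 : x^-1 = (v - u) * (v + u).
  by rewrite -subr_sqr sv su -mulrBl -natrB ?leqnSn // subSnn mul1r.
have vu : 0 < v - u.
  by have : 0 < (v - u) * (v + u); [rewrite -x1 invr_gt0|rewrite pmulr_lgt0 //; lra].
have xE : x = ((v - u) * (v + u))^-1 by rewrite -x1 invrK.
have [vN0 uvN0] : v != 0 /\ v - u != 0 by rewrite !gt_eqF.
have [wN0 v1 u1] : [/\ v + u != 0, 1 + v != 0 & 1 + u != 0].
  by split; rewrite gt_eqF //; lra.
have th2 : theta (x / n.+1%:R) <= M * ((v + u) * (1 + u) * (1 + v))^-1.
  apply: le_trans th _; rewrite ler_wpM2l ?(ltW M_gt0) //.
  have -> : v^-1 ^+ 3 / (2 * (1 + v^-1) ^+ 2) = (2 * v * (1 + v) ^+ 2)^-1.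
    by field; rewrite v1 vN0.
  rewrite lef_pV2 ?posrE; last 2 first.
  - by rewrite !mulr_gt0 ?exprn_gt0 //; lra.
  - by rewrite !mulr_gt0 //; lra.
  rewrite expr2 mulrA; apply: ler_pM; rewrite ?mulr_ge0 //; try lra.
  by apply: ler_pM; lra.
have -> : M * x * (v / (1 + v)) = M * x * (u / (1 + u)) + M * ((v + u) * (1 + u) * (1 + v))^-1.
  by rewrite xE; field; rewrite ?v1 ?u1 ?wN0 ?uvN0.
exact: lerD.
Qed.

(** The terms of the right-hand sum are grouped into blocks of [m]: for j <= i m one has m x / j >=
    x / i, so by monotonicity the i-th block dominates m theta(x / i). *)
Lemma theta_sum_superlinear n m x : 0 <= x -> m%:R * theta_sum n x <= theta_sum (n * m) (m%:R * x).
Proof.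
move=> x0; elim: n => [|n IHn]; first by rewrite mul0n /theta_sum !big_ord0 mulr0.
rewrite mulSnr /theta_sum big_split_ord /= big_ord_recr /= mulrDr; apply: lerD => //.
rewrite mulr_natl -[X in _ *+ X]card_ord -sumr_const; apply: ler_sum => i _.
apply: theta_le; first by rewrite divr_ge0.
rewrite ler_pdivrMr // mulrAC ler_pdivlMr // (mulrC m%:R) -mulrA -natrM ler_wpM2l // ler_nat.
by rewrite -addnS mulnS [leqRHS]addnC mulnC leq_add2l.
Qed.

(** The truncation [n] varies together with [x], so the supremum concerns the full sums without an
    infinite sum being formed. *)
Definition theta_ratios : set R :=
  [set y | exists n x, 0 < x /\ y = theta_sum n x / x].

Definition theta_rate : R := sup theta_ratios.

Lemma has_sup_theta_ratios : has_sup theta_ratios.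
Proof.
have [M Mb] := theta_sum_bound; split.
  by exists (theta_sum 0 1 / 1), 0%N, 1.
by exists M => _ [n [x [x0 ->]]]; rewrite ler_pdivrMr //; exact: Mb.
Qed.

Lemma theta_sum_le_rate n x : 0 < x -> theta_sum n x <= theta_rate * x.
Proof.
move=> x0; rewrite -ler_pdivrMr //; apply: (ub_le_sup has_sup_theta_ratios.2).
by exists n, x.
Qed.

Lemma theta_sum_ge0 n x : 0 <= x -> 0 <= theta_sum n x.
Proof. by move=> x0; apply: sumr_ge0 => i _; rewrite theta_ge0 // divr_ge0. Qed.

(** A Fekete-type argument: a ratio nearly attaining the supremum at some [y] propagates to the
    multiples [m * y], and rounding [x] down to such a multiple costs at most the constant
    [(theta_rate - e) * y]. *)
Lemma theta_sum_ge_rate e : 0 < e ->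
  exists K, forall x, 0 < x -> exists n, (theta_rate - e) * x - K <= theta_sum n x.
Proof.
move=> e0; have [_ [n [y [y0 ->]]] ey] := sup_adherent e0 has_sup_theta_ratios.
rewrite -/theta_rate in ey.
have [re0|re0] := leP (theta_rate - e) 0.
  exists 0 => x x0; exists 0%N; rewrite subr0; apply: le_trans (theta_sum_ge0 _ (ltW x0)).
  by rewrite mulr_le0_ge0 // ltW.
exists ((theta_rate - e) * y) => x x0; set m := Num.truncn (x / y).
have /andP[mx xm] : m%:R <= x / y < m.+1%:R by apply: truncn_itv; rewrite divr_ge0 ?ltW.
exists (n * m)%N; rewrite ler_pdivlMr // in mx; rewrite ltr_pdivrMr // mulrSr mulrDl mul1r in xm.
apply: (@le_trans _ _ (theta_sum (n * m) (m%:R * y))); last first.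
  apply: ler_sum => i _; apply: theta_le; first by rewrite divr_ge0 // mulr_ge0 // ltW.
  by rewrite ler_wpM2r.
apply: le_trans (theta_sum_superlinear _ _ (ltW y0)).
rewrite -mulrBr; apply: (@le_trans _ _ (m%:R * ((theta_rate - e) * y))).
  rewrite mulrCA ler_wpM2l ?(ltW re0) //; lra.
rewrite ler_wpM2l //; apply: ltW; by rewrite -ltr_pdivlMr.
Qed.

Lemma theta_rate_gt0 : 0 < theta_rate.
Proof.
(* At this point the single term of the sum is - ln (rho 4), and [rho 4] is at most 30 / 64. *)
have x0 : 0 < (4 : R) `^ p^-1 by rewrite powR_gt0.
rewrite -(pmulr_lgt0 _ x0); apply: lt_le_trans (theta_sum_le_rate 1 x0).
rewrite /theta_sum big_ord_recr big_ord0 /= add0r divr1 /theta -powRrM mulVf; last first.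
  by rewrite gt_eqF // (lt_trans ltr01).
rewrite powRr1 // oppr_gt0 ln_lt0 // rho_gt0 //= /rho.
rewrite ltr_pdivrMr ?exprn_gt0 // mul1r; have := sin_geN1 (4 : R); lra.
Qed.

(** Each of the [n] terms is at most M sqrt x, and completing the square bounds c sqrt x by e x +
    c^2 / e. *)
Lemma theta_sum_sublinear n e : 0 < e ->
  exists K, forall x, 0 < x -> theta_sum n x <= e * x + K.
Proof.
have [M M0 Mb] := theta_bound; move=> e0; exists ((n%:R * M) ^+ 2 / e) => x x0.
have q0 : 0 < Num.sqrt x by rewrite sqrtr_gt0.
apply: (@le_trans _ _ (n%:R * (M * Num.sqrt x))).
  rewrite mulr_natl -[X in _ *+ X]card_ord -sumr_const; apply: ler_sum => i _.
  apply: (@le_trans _ _ (theta x)).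
    apply: theta_le; first by rewrite divr_ge0 // ltW.
    by rewrite ler_pdivrMr // ler_peMr ?(ltW x0) // ler1n.
  apply: le_trans (Mb _ x0) _; rewrite ler_wpM2l ?(ltW M0) //.
  rewrite ler_pdivrMr; last by rewrite mulr_gt0 // exprn_gt0 // addr_gt0.
  rewrite exprS ler_wpM2l ?(ltW q0) //.
  have : Num.sqrt x ^+ 2 <= (1 + Num.sqrt x) ^+ 2.
    by rewrite lerXn2r ?nnegrE ?addr_ge0 ?(ltW q0) // lerDr.
  have := sqr_ge0 (Num.sqrt x); lra.
rewrite mulrA; set c := n%:R * M.
have xq : x = Num.sqrt x ^+ 2 by rewrite sqr_sqrtr // ltW.
rewrite {2}xq; move: (Num.sqrt x) => q.
rewrite -subr_ge0.
have -> : e * q ^+ 2 + c ^+ 2 / e - c * q =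
  (e * (q - c / (2 * e)) ^+ 2 + 3 / 4 * (c ^+ 2 / e)) by field; rewrite gt_eqF.
by rewrite addr_ge0 // mulr_ge0 ?(ltW e0) ?sqr_ge0 // ?divr_ge0 ?sqr_ge0 // ltW.
Qed.

End Asymptotics.

(** * Tail estimates for the power scales *)

Section Scales.
Set Implicit Arguments.
Unset Strict Implicit.
Unset Printing Implicit Defensive.
Context {R : realType}.
Implicit Types (q y e : R) (n m : nat).

(* With z = y + 1, (y / z)^-q = exp (- q ln (1 - 1 / z)) >= 1 + q / z. *)
Lemma powR_telescope q y : 0 < q -> 0 < y ->
  (y + 1) `^ (- (q + 1)) <= q^-1 * y `^ (- q) - q^-1 * (y + 1) `^ (- q).
Proof.
move=> q0 y0; set z := y + 1; have z0 : 0 < z by rewrite addr_gt0.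
rewrite -mulrBr ler_pdivlMl // opprD powRD; last by rewrite (gt_eqF z0) implybT.
rewrite powR_inv1 ?(ltW z0) //.
have yz : y = z * (y / z) by field; rewrite gt_eqF.
have yz0 : 0 < y / z by rewrite divr_gt0.
rewrite [in leRHS]yz powRM ?(ltW z0) ?(ltW yz0) //.
have : 1 + q / z <= (y / z) `^ (- q).
  rewrite /powR gt_eqF //; apply: le_trans (expR_ge1Dx _).
  rewrite lerD2l mulNr -mulrN ler_wpM2l ?(ltW q0) //.
  have -> : y / z = 1 + (- z^-1) by rewrite /z; field; rewrite gt_eqF.
  rewrite lerNr; apply: le_ln1Dx.
  by rewrite ltrN2 invf_lt1 // /z; lra.
have := powR_gt0 (- q) z0; move: (z `^ (- q)) ((y / z) `^ (- q)) => s t s0 st.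
have : s * (1 + q / z) <= s * t by rewrite ler_wpM2l // ltW.
by rewrite mulrDr; lra.
Qed.

Lemma powRN_small q e : 0 < q -> 0 < e ->
  exists m, forall n, (m <= n)%N -> n.+1%:R `^ (- q) <= e.
Proof.
move=> q0 e0; exists (Num.truncn (e^-1 `^ q^-1)) => n mn.
rewrite powRN -[leRHS]invrK lef_pV2 ?posrE ?invr_gt0 ?powR_gt0 //.
have {1}-> : e^-1 = (e^-1 `^ q^-1) `^ q.
  by rewrite -powRrM mulVf ?gt_eqF // powRr1 // invr_ge0 ltW.
apply: ge0_ler_powR; rewrite ?nnegrE ?powR_ge0 ?(ltW q0) //.
apply: le_trans (ltW (truncnS_gt _)) _.
by rewrite ler_nat ltnS.
Qed.

Lemma powRN_cvg0 q m : 0 < q -> (m + n).+1%:R `^ (- q) @[n --> \oo] --> (0 : R).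
Proof.
move=> q0; apply/cvgrPdist_le => e e0; have [k kH] := powRN_small q0 e0.
near=> n; rewrite sub0r normrN ger0_norm ?powR_ge0 //; apply: kH.
by apply: leq_trans (leq_addl _ _); near: n; exact: nbhs_infty_ge.
Unshelve. all: by end_near. Qed.

End Scales.

(** * The Fourier transform of an even bump as a cosine integral *)

Section FourierTransform.
Set Implicit Arguments.
Unset Strict Implicit.
Unset Printing Implicit Defensive.
Context {R : realType}.
Variable F : R -> R.
Hypothesis F_supp : forall x, 1 < `|x| -> F x = 0.
Hypothesis F_even : forall x, F (- x) = F x.
Hypothesis F_continuous : continuous F.
Local Notation mu := (@lebesgue_measure R).

Lemma Rintegral_supp (g : R -> R) : (forall x, 1 < `|x| -> g x = 0) ->
  \int[mu]_x g x = \int[mu]_(x in `[- 2, 2]) g x.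
Proof.
move=> g0; rewrite [RHS]Rintegral_mkcond; apply: eq_Rintegral => x _.
rewrite patchE; case: ifPn => //; rewrite notin_setE /= in_itv /= => h.
apply: g0; rewrite ltNge; apply/negP; rewrite ler_norml => /andP[h1 h2].
by apply: h; apply/andP; split; lra.
Qed.

Lemma fourier_Re k : complex.Re (fourier F k) = fcos (2 * pi * k) F.
Proof.
rewrite /fourier /cintegral /= Rintegral_supp => [|x x1]; last first.
  by rewrite F_supp // !mulr0 subrr.
by apply: eq_Rintegral => x _; rewrite mulr0 subr0 cosN mulrC.
Qed.

(** The integrand is odd, hence its antiderivative [s] is even and takes equal values at both
    ends. *)
Lemma fourier_Im k : complex.Im (fourier F k) = 0.
Proof.
rewrite /fourier /cintegral /= Rintegral_supp => [|x x1]; last first.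
  by rewrite F_supp // !mulr0 addr0.
have -> : \int[mu]_(x in `[- 2, 2]) (cos (- (2 * pi * k * x)) * 0
    + sin (- (2 * pi * k * x)) * F x) =
    \int[mu]_(x in `[- 2, 2]) (sin (- (2 * pi * k * x)) * F x).
  by apply: eq_Rintegral => x _; rewrite mulr0 add0r.
have hc : continuous (fun x => sin (- (2 * pi * k * x)) * F x) by cont.
have [s sd] := antiderivative hc.
rewrite (Rintegral_FTC _ hc sd); last lra.
have := @has_deriv_eq0_cst _ (fun x => s x - s (- x)) _ 2 0.
rewrite oppr0 subrr; apply=> x; apply: has_deriv_eq; first by der.
by rewrite /= F_even (mulrN (2 * pi * k) x) !sinN; ring.
Qed.

(** This covers the frequency 0, whereas the product formula is stated for positive frequencies. *)
Lemma fcos_le0 w : (forall x, 0 <= F x) -> fcos w F <= fcos 0 F.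
Proof.
move=> F0; apply: le_Rintegral; [exact: measurable_itv|
  apply: continuous_integrable; by cont..|].
by move=> x _; rewrite ler_wpM2l // mul0r cos0 cos_le1.
Qed.

End FourierTransform.

(** * The bump with power-law widths and its transform *)

Section Assembly.
Set Implicit Arguments.
Unset Strict Implicit.
Unset Printing Implicit Defensive.
Context {R : realType}.
Implicit Types (w x y e : R) (n m N : nat).

Section Tail.
Variable p : R.
Hypothesis p_gt1 : 1 < p.

Definition theta_tail N n x : R := \sum_(i < n) theta p (x / (N + i).+1%:R).

Lemma theta_tailE N n x : theta_sum p (N + n) x = theta_sum p N x + theta_tail N n x.
Proof. by rewrite /theta_sum big_split_ord. Qed.

Lemma theta_tail_le N n x y : 0 <= x -> x <= y -> theta_tail N n x <= theta_tail N n y.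
Proof.
move=> x0 xy; apply: ler_sum => i _; apply: theta_le => //; first by rewrite divr_ge0.
by rewrite ler_wpM2r.
Qed.

Lemma prod_rho c N n w : 0 < c -> 0 < w ->
  \prod_(i < n) rho (c * (N + i).+1%:R `^ (- p) * w) =
  expR (- theta_tail N n ((c * w) `^ p^-1)).
Proof.
move=> c0 w0; have p0 : 0 < p by apply: lt_trans p_gt1.
rewrite /theta_tail -sumrN expR_sum; apply: eq_bigr => i _.
have cw : 0 < c * w by rewrite mulr_gt0.
rewrite opprK powRM ?invr_ge0 ?powR_ge0 // -!powRrM mulVf ?gt_eqF //.
rewrite powRr1 ?(ltW cw) // -[X in _ * X `^ p]powR_inv1 // -powRrM mulN1r mulrAC.
by rewrite lnK // posrE rho_gt0 // mulr_gt0 // powR_gt0.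
Qed.

End Tail.

(** The tent has width [A N] and the averages have the widths from [A N.+1] on. The tent thus
    supplies the first factor of the product, which is why [n] averages give [n.+1] terms of the
    tail. *)
Lemma exists_bump (p c : R) : 1 < p -> 0 < c -> exists F : R -> R, exists N,
  [/\ smooth F, forall x, F (- x) = F x, forall x, 0 <= F x,
      forall x, 1 < `|x| -> F x = 0 &
      forall w, 0 < w ->
        expR (- theta_tail p N n.+1 ((c * w) `^ p^-1)) @[n --> \oo] --> fcos w F].
Proof.
move=> p1 c0; pose q := p - 1; have q0 : 0 < q by rewrite subr_gt0.
(* This choice makes the width of the tent plus all later widths, bounded by [A N + tau 0], at most
   1. *)
have [N HN] : exists N, c * (1 + q^-1) * N.+1%:R `^ (- q) <= 1.
  have [|N HN] := @powRN_small _ q (c * (1 + q^-1))^-1 q0.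
    by rewrite invr_gt0 mulr_gt0 // addr_gt0 // invr_gt0.
  exists N; rewrite mulrC -ler_pdivlMr ?mul1r ?HN //.
  by rewrite mulr_gt0 // addr_gt0 // invr_gt0.
pose A i : R := c * i.+1%:R `^ (- p).
pose a n := A (N + n.+1)%N.
(* This is the integral of c t^(-p) from N + n + 1 to infinity, which bounds the sum of the widths
   from [a n] on. *)
pose tau n : R := c * (q^-1 * (N + n).+1%:R `^ (- q)).
have A_gt0 i : 0 < A i by rewrite mulr_gt0 // powR_gt0.
have tau0 n : 0 < tau n by rewrite !mulr_gt0 ?invr_gt0 ?powR_gt0.
have tau_step n : a n <= tau n - tau n.+1.
  rewrite /a /A /tau -mulrBr ler_wpM2l ?(ltW c0) //.
  have -> : (N + n.+1).+1%:R = (N + n).+1%:R + 1 :> R by rewrite addnS -natr1.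
  by have := @powR_telescope _ q (N + n).+1%:R q0 (ltr0Sn _ _); rewrite {1}/q subrK.
have A1 : A N + tau 0%N <= 1.
  have h : c * N.+1%:R `^ (- p) <= c * N.+1%:R `^ (- q).
    rewrite ler_wpM2l ?(ltW c0) //; apply: ler_powR; first by rewrite ler1n.
    by rewrite lerN2 /q; lra.
  by apply: le_trans HN; rewrite /A /tau addn0; lra.
have a_gt0 n : 0 < a n by exact: A_gt0.
have tau_le n : tau n <= tau 0%N.
  elim: n => [|n IHn]; first exact: lexx.
  apply: le_trans IHn; rewrite -subr_ge0; apply: le_trans (tau_step n).
  exact: ltW (a_gt0 n).
have a_lt1 n : a n < 1.
  apply: le_lt_trans (tau_step n) _; apply: lt_le_trans A1.
  rewrite ltrBlDr; apply: le_lt_trans (tau_le n) _.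
  by rewrite -addrA addrCA ltrDl addr_gt0.
have tau_cvg : tau n @[n --> \oo] --> (0 : R).
  rewrite -(mulr0 c); apply: cvgM; first exact: cvg_cst.
  rewrite -(mulr0 q^-1); apply: cvgM; first exact: cvg_cst.
  exact: powRN_cvg0.
have AN0 := A_gt0 N.
have AN1 : A N <= 1 by apply: le_trans A1; rewrite lerDl ltW.
have aE n : a n = A (N + n.+1)%N by [].
clearbody tau a.
have fl := fun x y => @tent_lipschitz R (A N) x y AN0.
have f0 := fun x => @tent_ge0 R (A N) x AN0.
have fe := @tent_even R (A N).
have fs x : A N < `|x| -> tent (A N) x = 0 by move=> /ltW; exact: tent_supp.
exists (conv_limit a (tent (A N)) 0), N; split.
- exact: (conv_limit_smooth a_gt0 tau_step tau_cvg fl).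
- by move=> x; exact: conv_limit_even.
- move=> x; apply: (conv_limit_ge0 a_gt0 tau_step tau_cvg fl f0).
- by move=> x; apply: (conv_limit_supp a_gt0 tau_step tau_cvg fs A1).
move=> w w0.
rewrite (_ : (fun n => _) =
  (fun n => \prod_(i < n) rho (a i * w) * fcos w (tent (A N)))).
  exact: (fcos_conv_limit a_gt0 a_lt1 tau_step tau_cvg fl f0 fs A1).
apply/funext => n.
rewrite fcos_tent ?AN0 ?AN1 // -prod_rho // big_ord_recl /= addn0 mulrC.
by congr (_ * _); apply: eq_bigr => i _; rewrite aE.
Qed.

End Assembly.

(** * Calibration of the scales, monotonicity and the two-sided decay estimate *)

Theorem mainTheorem1 (R : realType) (delta C : R)
    (delta_gt0 : 0 < delta) (delta_lt1 : delta < 1) (C_gt0 : 0 < C) :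
  exists F : R -> R,
    smooth F /\
    (forall x : R, F (- x) = F x) /\
    (forall x : R, 0 <= F x) /\
    supp F `<=` [set x : R | -1 <= x <= 1] /\
    (forall k : R, complex.Im (fourier F k) = 0) /\
    (forall k l : R, 0 <= k -> k <= l ->
       complex.Re (fourier F l) <= complex.Re (fourier F k)) /\
    (forall eps : R, 0 < eps ->
       lesssim [set k : R | 0 <= k]
         (fun k : R => expR (- ((1 + eps) * C * k `^ delta)))
         (fun k : R => complex.Re (fourier F k)) /\
       lesssim [set k : R | 0 <= k]
         (fun k : R => complex.Re (fourier F k))
         (fun k : R => expR (- ((1 - eps) * C * k `^ delta)))).
Proof.
set p := delta^-1.
have p1 : 1 < p by rewrite /p invf_gt1.
have I0 := theta_rate_gt0 p1; set I := theta_rate p in I0.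
have pi0 := pi_gt0 R.
(* Chosen so that (2 pi c k)^delta = (C / I) k^delta; the exponent I x is then exactly C k^delta. *)
pose c := (C / I) `^ p / (2 * pi).
have c0 : 0 < c by rewrite divr_gt0 ?mulr_gt0 // powR_gt0 // divr_gt0.
have [F [N [Fsmooth Feven F0 Fsupp Flim]]] := exists_bump p1 c0.
have Fc : continuous F.
  move=> x; apply: differentiable_continuous; apply/derivable1_diffP.
  exact: Fsmooth 0%N x.
pose X k : R := C / I * k `^ delta.
have XE k : 0 < k -> (c * (2 * pi * k)) `^ p^-1 = X k.
  move=> k0; rewrite /c mulrA mulfVK ?gt_eqF ?mulr_gt0 //.
  rewrite powRM ?powR_ge0 ?(ltW k0) // -powRrM mulfV ?gt_eqF ?(lt_trans ltr01) //.
  by rewrite powRr1 ?divr_ge0 ?(ltW C_gt0) ?(ltW I0) // /p invrK.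
have X0 k : 0 < k -> 0 < X k by move=> k0; rewrite mulr_gt0 ?powR_gt0 // divr_gt0.
have XI k : I * X k = C * k `^ delta by rewrite /X; field; rewrite gt_eqF.
pose h k := complex.Re (fourier F k).
have hlim k : 0 < k -> expR (- theta_tail p N n.+1 (X k)) @[n --> \oo] --> h k.
  move=> k0; rewrite /h fourier_Re // -XE //.
  by apply: Flim; rewrite !mulr_gt0.
have h_le k l : 0 < k -> k <= l -> h l <= h k.
  move=> k0 kl; have l0 : 0 < l by apply: lt_le_trans kl.
  apply: (ler_cvg_to (hlim l l0) (hlim k k0)); apply: nearW => n.
  rewrite ler_expR lerN2; apply: theta_tail_le => //; first exact: ltW (X0 _ k0).
  rewrite ler_wpM2l ?divr_ge0 ?(ltW C_gt0) ?(ltW I0) //.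
  by apply: ge0_ler_powR; rewrite ?nnegrE ?(ltW delta_gt0) ?(ltW k0) ?(ltW l0).
have h_le0 k : h k <= h 0 by rewrite /h !fourier_Re // mulr0 fcos_le0.
(* The tail is part of a full sum, which is at most [I * X k]: omitting the first factors can only
   raise the transform. *)
have h_ge k : 0 < k -> expR (- (C * k `^ delta)) <= h k.
  move=> k0; apply: (cvgr_to_ge (hlim k k0)); apply: nearW => n.
  rewrite ler_expR lerN2 -XI; apply: le_trans (theta_sum_le_rate p1 (N + n.+1) (X0 _ k0)).
  by rewrite theta_tailE lerDr theta_sum_ge0 // ltW // X0.
(* All factors are at most 1, so every finite partial product is an upper bound. *)
have h_upper n k : 0 < k -> h k <= expR (- theta_tail p N n (X k)).
  move=> k0; apply: (cvgr_to_le (hlim k k0)); near=> m.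
  have nm : (n <= m.+1)%N by apply: leqW; near: m; exact: nbhs_infty_ge.
  rewrite ler_expR lerN2; have := @theta_sum_le0 _ _ p1 (N + n) (N + m.+1) _ (ltW (X0 k k0)).
  by rewrite leq_add2l nm !theta_tailE lerD2l; apply.
exists F; split=> //; split=> //; split=> //; split.
  have cl : closed [set x : R | -1 <= x <= 1].
    by rewrite -set_itvcc; exact: itv_closed.
  rewrite [X in _ `<=` X](closure_id _).1 //; apply: closure_subset => x /= Fx.
  rewrite -ler_norml leNgt; apply: contra_neqN Fx; exact: Fsupp.
split; first by move=> k; exact: fourier_Im.
split.
  move=> k l; rewrite le_eqVlt => /predU1P[<- _|]; [exact: h_le0|exact: h_le].
(* Half of the loss [e * I] goes to the lower bound on the full sum, the other half to the [N]
   omitted terms. *)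
move=> e e0; have eI : 0 < e * I / 2 by rewrite divr_gt0 // mulr_gt0.
split.
  (* The constant serves [k = 0], where [h 0 >= h 1 >= expR (- C)]; for positive [k] the constant 1
     would do. *)
  exists (expR C); first exact: expR_gt0.
  move=> k /=; rewrite le_eqVlt => /predU1P[<-|k0].
    rewrite powR0 ?gt_eqF // mulr0 oppr0 expR0.
    have := h_ge 1 ltr01; rewrite powR1 mulr1 => h1.
    rewrite -[X in X <= _](expRxMexpNx_1 C); apply: ler_wpM2l; first exact: expR_ge0.
    exact: (le_trans h1 (h_le0 1)).
  apply: (@le_trans _ _ (1 * h k)); last first.
    apply: ler_wpM2r; first exact: le_trans (expR_ge0 _) (h_ge k k0).
    by rewrite -expR0 ler_expR ltW.
  rewrite mul1r; apply: le_trans (h_ge k k0).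
  rewrite ler_expR lerN2 -mulrA ler_peMl //; last by lra.
  by rewrite mulr_ge0 ?powR_ge0 // ltW.
have [K1 HK1] := theta_sum_ge_rate p1 eI.
have [K2 HK2] := theta_sum_sublinear p1 N eI.
(* The value [h 0] takes care of [k = 0], the exponential of the additive errors of positive [k]. *)
exists (Num.max (h 0) (expR (K1 + K2))); first by rewrite lt_max expR_gt0 orbT.
move=> k /=; rewrite le_eqVlt => /predU1P[<-|k0].
  have -> : (1 - e) * C * 0 `^ delta = 0 by rewrite powR0 ?gt_eqF // mulr0.
  by rewrite oppr0 expR0 mulr1 le_max lexx.
apply: (@le_trans _ _ (expR (K1 + K2) * expR (- ((1 - e) * C * k `^ delta)))); last first.
  by rewrite ler_wpM2r ?expR_ge0 // le_max lexx orbT.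
have [n Hn] := HK1 _ (X0 k k0).
apply: le_trans (h_upper n k k0) _; rewrite -expRD ler_expR.
have := HK2 _ (X0 k k0).
have := @theta_sum_le0 _ _ p1 n (N + n) _ (ltW (X0 k k0)) (leq_addl _ _).
rewrite theta_tailE -(mulrA (1 - e)) -XI; move: Hn; rewrite -/I; lra.
Unshelve. all: by end_near. Qed.
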